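(* Let $d,m\in\mathbb{N}$, $A\in\mathbb{R}^{d\times d}$ and $B\in\mathbb{R}^{d\times m}$. Assume that all eigenvalues of $A$ lie in the closed unit disk, and that every eigenvalue $\lambda$ of $A$ with $|\lambda|=1$ has equal algebraic and geometric multiplicities. Assume the pair $(A,B)$ is stabilizable. Let $(w_t)_{t\in\mathbb{N}_0}$ be a sequence of mutually independent $\mathbb{R}^d$-valued random vectors (not necessarily identically distributed) with $\mathsf{E}[w_t]=0$, $\mathsf{E}[w_tw_t^{\mathrm T}]=Q_t$, and $\sup_{t\in\mathbb{N}_0}\mathsf{E}[\|w_t\|^4]<\infty$. Consider the system $$x_{t+1}=Ax_t+Bu_t+w_t,\qquad x_0=x,\quad t\in\mathbb{N}_0 .$$ Then there exist $R>0$, an integer $k\le d$, and a deterministic $k$-history-dependent policy $(\pi_t)_{t\in\mathbb{N}_0}$, i.e. measurable maps $\pi_t:\mathbb{R}^{d\times k}\to\mathbb{R}^m$ with $\|\pi_t(\cdot)\|\le R$ for every $t$, such that, for the closed-loop system $$x_{t+1}=Ax_t+B\pi_t(x_t,x_{t-1},\ldots,x_{t-k+1})+w_t,\qquad x_0=x,\quad t\in\mathbb{N}_0,$$ (with the convention $x_{-k+1}=\cdots=x_{-1}=x_0$): (P1) for every fixed $x\in\mathbb{R}^d$ the process $(x_t)_{t\in\mathbb{N}_0}$ satisfies $\sup_{t\in\mathbb{N}_0}\mathsf{E}_x[\|x_t\|^2]<\infty$; and (P2) in the absence of noise (i.e. with $w_t\equiv 0$) the origin is asymptotically stable for the closed-loop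 system.
   Context: $\|\cdot\|$ denotes the Euclidean norm. $\mathsf{E}_x$ denotes expectation given the initial condition $x_0=x$ (deterministic). Stabilizable means there is a matrix $K$ with $A+BK$ having all eigenvalues in the open unit disk. *)

(* Defs.v *)
From HB Require Import structures.
From mathcomp Require Import all_boot all_order all_algebra.
From mathcomp Require Import all_classical all_reals all_analysis.
From mathcomp Require Import complex.
Set Implicit Arguments. Unset Strict Implicit. Unset Printing Implicit Defensive.
Import Order.TTheory GRing.Theory Num.Theory.
Local Open Scope classical_set_scope.
Local Open Scope ring_scope.

Definition toC (R : realType) (p q : nat) (M : 'M[R]_(p, q)) : 'M[R[i]]_(p, q) :=
  map_mx (fun x : R => Complex x 0) M.

Definition enorm (R : realType) (n : nat) (v : 'cV[R]_n) : R :=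
  Num.sqrt (\sum_(i < n) v i 0 ^+ 2).

Definition stabilizable (R : realType) (d m : nat) (A : 'M[R]_d) (B : 'M[R]_(d, m)) : Prop :=
  exists K : 'M[R]_(m, d),
    forall l : R[i], eigenvalue (toC (A + B *m K)) l -> `|l| < 1.

Definition mx_rect (R : realType) (p q : nat) : set (set 'M[R]_(p, q)) :=
  [set S | exists Bs : 'I_p -> 'I_q -> set R,
      (forall i j, measurable (Bs i j)) /\ S = [set M : 'M[R]_(p, q) | forall i j, Bs i j (M i j)]].
Definition mx_borel (R : realType) (p q : nat) : set (set 'M[R]_(p, q)) :=
  <<s @mx_rect R p q >>.
Definition mx_measurable_fun (R : realType) (p q r s : nat)
    (f : 'M[R]_(p, q) -> 'M[R]_(r, s)) : Prop :=
  forall S, @mx_borel R r s S -> @mx_borel R p q (f @^-1` S).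

(* history matrix: column j is the state j steps back; s = [:: x_t; ...; x_0],
   states before time 0 are equal to x_0 (the default of nth) *)
Definition hist (R : realType) (d k : nat) (x0 : 'cV[R]_d) (s : seq 'cV[R]_d) : 'M[R]_(d, k) :=
  \matrix_(i < d, j < k) (nth x0 s j) i 0.

Fixpoint cl_states (R : realType) (d m k : nat) (A : 'M[R]_d) (B : 'M[R]_(d, m))
    (pi : nat -> 'M[R]_(d, k) -> 'cV[R]_m) (w : nat -> 'cV[R]_d) (x : 'cV[R]_d)
    (t : nat) : seq 'cV[R]_d :=
  match t with
  | 0 => [:: x]
  | t'.+1 => let s := cl_states A B pi w x t' in
             (A *m head x s + B *m pi t' (hist k x s) + w t') :: s
  end.

Definition cl_traj (R : realType) (d m k : nat) (A : 'M[R]_d) (B : 'M[R]_(d, m))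
    (pi : nat -> 'M[R]_(d, k) -> 'cV[R]_m) (w : nat -> 'cV[R]_d) (x : 'cV[R]_d)
    (t : nat) : 'cV[R]_d :=
  head x (cl_states A B pi w x t).

Definition asymp_stable (R : realType) (d : nat) (traj : 'cV[R]_d -> nat -> 'cV[R]_d) : Prop :=
  (forall e : R, 0 < e -> exists2 delta : R, 0 < delta &
     forall x, enorm x < delta -> forall t, enorm (traj x t) < e) /\
  (exists2 delta : R, 0 < delta & forall x, enorm x < delta ->
     forall e : R, 0 < e -> exists N : nat, forall t, (N <= t)%N -> enorm (traj x t) < e).

Definition rv_sigma (R : realType) (dO : measure_display) (Omega : measurableType dO)
    (n : nat) (X : Omega -> 'cV[R]_n) : set (set Omega) :=
  <<s [set E | exists (i : 'I_n) (Bs : set R), measurable Bs /\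
                 E = (fun om => X om i 0) @^-1` Bs] >>.

Definition mutually_independent (R : realType) (dO : measure_display) (Omega : measurableType dO)
    (P : probability Omega R) (n : nat) (X : nat -> Omega -> 'cV[R]_n) : Prop :=
  forall (S : seq nat) (E : nat -> set Omega), uniq S ->
    (forall t, t \in S -> rv_sigma (X t) (E t)) ->
    P [set om | forall t, t \in S -> E t om] = (\prod_(t <- S) P (E t))%E.

(* Main.v *)
(* Semisimplicity of the unit-modulus eigenvalues means that the minimal
   polynomial of A has only simple roots on the unit circle.  The corresponding
   spectral projections give a real matrix Y, spanning the left eigenvectors of
   unit modulus, such that |Y A x| = |Y x| for all x and A is exponentially
   stable on ker Y.  Stabilizability makes Y x steerable to 0 in d steps.

   The policy works in blocks of d steps: from the state z at the start of a
   block it plays the input that would annihilate Y x at the end of the block,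
   scaled down by 1 / max(1, |Y z|).  Hence y_q := Y x_{qd} satisfies
   |E[y_{q+1} | past]| = (|y_q| - 1)^+, with a noise of bounded fourth moment.
   The usual drift argument for |y|^2 only bounds time averages of E|y_q|; the
   uniform second moment bound comes from the time-dependent Lyapunov functions
   V_k(y) = |y|^4 / (|y|^2 + k^2), for which
   E V_k(y_{q+1}) <= E V_{k+1}(y_q) + C / k^2.
   Iterating backwards gives sup_q E V_1(y_q) < oo, and V_1(y) >= |y|^2 - 1.
   The component of x along ker Y is then a stable linear filter of square
   integrable inputs.  Without noise Y x vanishes after the first block, for
   small initial states. *)
Require Import Defs.
From HB Require Import structures.
From mathcomp Require Import all_boot all_order all_algebra.
From mathcomp Require Import all_classical all_reals all_analysis.
From mathcomp Require Import complex.
From mathcomp Require Import measurable_realfun.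
From mathcomp Require Import ring lra.
Import Order.TTheory GRing.Theory Num.Theory.
Local Open Scope classical_set_scope.
Local Open Scope ring_scope.

(** * Spectral structure of the system matrix *)

Lemma char_poly_similar (F : fieldType) (n k : nat) (e : k = n) (M : 'M[F]_n)
    (U : 'M[F]_(k, n)) (V : 'M[F]_(n, k)) :
  U *m V = 1%:M -> char_poly (U *m M *m V) = char_poly M.
Proof.
case: n / e M U V => M U V UV1.
have VU1 : V *m U = 1%:M by apply: mulmx1C.
pose f := polyC : F -> {poly F}.
have fUV : map_mx f U *m map_mx f V = 1%:M by rewrite -map_mxM UV1 map_mx1.
rewrite /char_poly.
have -> : char_poly_mx (U *m M *m V)
    = map_mx f U *m char_poly_mx M *m map_mx f V.
  rewrite /char_poly_mx !map_mxM mulmxBr mulmxBl mul_mx_scalar -scalemxAl fUV.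
  by rewrite scalemx1.
rewrite !det_mulmx mulrAC -det_mulmx fUV det1 mul1r //.
Qed.

Lemma char_poly_lblock (F : fieldType) (g h : nat) (a : F)
    (C : 'M[F]_(h, g)) (D : 'M[F]_h) :
  char_poly (block_mx (a%:M : 'M[F]_g) 0 C D)
  = ('X - a%:P) ^+ g * char_poly D.
Proof.
rewrite /char_poly /char_poly_mx map_block_mx /= map_scalar_mx map_mx0.
rewrite (@scalar_mx_block _ g h) opp_block_mx add_block_mx oppr0 addr0.
by rewrite det_lblock -raddfN -raddfD det_scalar.
Qed.

(** Modulo the rows of [V], multiplying [W] by a polynomial in [M] amounts to multiplying it by the
    same polynomial in [D], and Cayley-Hamilton makes [D] vanish in its own characteristic
    polynomial. *)
Lemma horner_mx_extension (F : fieldType) (n g h : nat) (M : 'M[F]_n.+1)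
    (V : 'M[F]_(g, n.+1)) (W : 'M[F]_(h, n.+1)) (a : F) (C : 'M[F]_(h, g))
    (D : 'M[F]_h) :
  V *m M = a *: V -> W *m M = C *m V + D *m W ->
  exists X, W *m horner_mx M (char_poly D) = X *m V.
Proof.
move=> VM WM; case: h => [|h] in W C D WM *.
  by exists 0; rewrite [W]flatmx0 !mul0mx.
suff /(_ (char_poly D)) [X ->] : forall p : {poly F},
    exists X, W *m horner_mx M p = X *m V + horner_mx D p *m W.
  by exists X; rewrite Cayley_Hamilton mul0mx addr0.
elim/poly_ind => [|p c [X IH]].
  by exists 0; rewrite !rmorph0 mulmx0 !mul0mx addr0.
exists (a *: X + horner_mx D p *m C).
rewrite !rmorphD !rmorphM /= !horner_mx_C !horner_mx_X mulmxDr.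
rewrite -[horner_mx M p * M]/(horner_mx M p *m M) mulmxA IH mulmxDl -!mulmxA.
rewrite VM WM mulmxDr mulmxDl mulmxDl -!scalemxAr -!scalemxAl !mulmxA.
by rewrite mul_mx_scalar mul_scalar_mx !addrA.
Qed.

(** Completing a basis of the left eigenspace to a basis of the whole space makes [M] block
    triangular with a scalar block; [r] is the characteristic polynomial of the other block. The
    second identity bounds the multiplicity of [a] in the minimal polynomial by one more than its
    multiplicity in [r]. *)
Lemma eigenspace_deflation (F : fieldType) (n : nat) (M : 'M[F]_n.+1) (a : F) :
  exists r : {poly F},
    char_poly M = ('X - a%:P) ^+ (\rank (eigenspace M a)) * r
    /\ horner_mx M (r * ('X - a%:P)) = 0.
Proof.
set E := eigenspace M a.
pose V := row_base E; pose W := row_base E^C%MS; pose U := col_mx V W.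
have dimE : (\rank E + \rank E^C = n.+1)%N.
  by rewrite mxrank_compl subnKC // rank_leq_row.
have Ufull : row_full U.
  rewrite -sub1mx -addsmxE (adds_eqmx (eq_row_base _) (eq_row_base _)) sub1mx.
  exact: addsmx_compl_full.
have Ufree : row_free U.
  by rewrite /row_free; move: Ufull => /eqP ->; rewrite dimE.
pose U' := pinvmx U.
have UU' : U *m U' = 1%:M by apply: mulmxVp.
have VM : V *m M = a *: V.
  by apply/eigenspaceP; rewrite eq_row_base.
have VU' : V *m U' = row_mx 1%:M 0.
  have := congr1 usubmx UU'.
  by rewrite mul_col_mx col_mxKu (@scalar_mx_block _ (\rank E)) /block_mx col_mxKu.
pose B := W *m M *m U'.
pose C := lsubmx B; pose D := rsubmx B.
have UMU' : U *m M *m U' = block_mx a%:M 0 C D.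
  rewrite /U !mul_col_mx VM -scalemxAl VU' -/B -[in LHS](hsubmxK B).
  by rewrite scale_row_mx scalemx1 scaler0.
have WM : W *m M = C *m V + D *m W.
  have : B *m U = W *m M by rewrite /B mulmxKpV // submx_full.
  by rewrite -[in LHS](hsubmxK B) mul_row_col => <-.
exists (char_poly D); split.
  by rewrite -(@char_poly_similar _ _ _ dimE M _ _ UU') UMU' char_poly_lblock.
have [X WX] := @horner_mx_extension _ _ _ _ _ _ _ _ _ _ VM WM.
have VMa : V *m horner_mx M ('X - a%:P) = 0.
  by rewrite rmorphB /= horner_mx_X horner_mx_C mulmxBr VM mul_mx_scalar subrr.
set Z := horner_mx _ _.
suff : U *m Z = 0 by move/(congr1 (mulmx (pinvmx U))); rewrite mulmxA mulVpmx // mul1mx mulmx0.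
rewrite /U mul_col_mx; apply/eqP; rewrite col_mx_eq0; apply/andP; split; apply/eqP.
  by rewrite /Z mulrC rmorphM /= [X in V *m X]/(_ *m _) mulmxA VMa mul0mx.
by rewrite /Z rmorphM /= [X in W *m X]/(_ *m _) mulmxA WX -mulmxA VMa mulmx0.
Qed.

(** The annihilator is the minimal polynomial, split by the modulus of its roots. A unit-modulus
    root is simple because equal multiplicities leave the cofactor [r] of the deflation without that
    root. *)
Lemma annihilator_split (C : numClosedFieldType) (n : nat) (M : 'M[C]_n.+1) :
  (forall l, eigenvalue M l -> `|l| <= 1) ->
  (forall l, eigenvalue M l -> `|l| = 1 ->
     mup l (char_poly M) = \rank (eigenspace M l)) ->
  exists us ss : seq C, [/\ uniq us, all (fun z => `|z| == 1) us,
    all (fun z => `|z| < 1) ss &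
    horner_mx M (\prod_(z <- us) ('X - z%:P) * \prod_(z <- ss) ('X - z%:P)) = 0].
Proof.
move=> le1 semi.
pose mu := mxminpoly M; have mu_mon : mu \is monic := mxminpoly_monic M.
have [s mus] := closed_field_poly_normal mu.
rewrite (monicP mu_mon) scale1r in mus.
have s_eig z : z \in s -> eigenvalue M z.
  by move=> zs; rewrite eigenvalue_root_min -/mu mus root_prod_XsubC.
exists [seq z <- s | `|z| == 1], [seq z <- s | `|z| != 1]; split.
- apply: count_mem_uniq => z.
  rewrite mem_filter count_filter; have [z1|] := boolP (`|z| == 1); last first.
    move=> z1; apply/eqP; rewrite -leqn0 leqNgt -has_count; apply/hasPn => y ys /=.
    by apply/negP => /andP[/eqP-> ]; apply/negP.
  rewrite (@eq_count _ _ (pred1 z)); last first.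
    by move=> y /=; case: eqP => [->|//]; rewrite z1.
  have [zs|zs] := boolP (z \in s); last by rewrite /=; apply/count_memPn.
  apply/eqP; rewrite /= eqn_leq -has_count has_pred1 zs andbT.
  rewrite -mu_prod_XsubC -mus.
  have [r [charE rM0]] := eigenspace_deflation _ _ M z.
  have char0 : char_poly M != 0 by rewrite monic_neq0 // char_poly_monic.
  have r0 : r != 0 by apply: contraNneq char0 => r0; rewrite charE r0 mulr0.
  have rz : ~~ root r z.
    have := semi _ (s_eig _ zs) (eqP z1).
    rewrite charE mupM ?expf_neq0 ?polyXsubC_eq0 // mup_XsubCX eqxx.
    move/eqP; rewrite -[X in _ == X]addn0 eqn_add2l => /eqP mr.
    by rewrite -dvdp_XsubCl XsubC_dvd // mr.
  have rX0 : r * ('X - z%:P) != 0 by rewrite mulf_neq0 ?polyXsubC_eq0.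
  have -> : 1%N = mup z (r * ('X - z%:P)).
    by rewrite mupMr // -[X in mup _ X]expr1 mup_XsubCX eqxx.
  rewrite mup_geq //; apply: dvdp_trans (mxminpoly_min rM0).
  by rewrite -mup_geq // monic_neq0.
- by apply/allP => z; rewrite mem_filter => /andP[].
- apply/allP => z; rewrite mem_filter => /andP[z1 zs].
  by rewrite lt_neqAle z1 le1 // s_eig.
- rewrite !big_filter -[X in horner_mx _ X](bigID (fun z => `|z| == 1) xpredT).
  by rewrite -mus mx_root_minpoly.
Qed.

(** For distinct roots, the products with one root omitted generate the unit ideal. In place of
    Bezout coefficients, the induction drops one root [a] at a time through (X - a) f p - (X - l) f
    p = (l - a) f p. *)
Lemma horner_eliminate (F : fieldType) (n k : nat) (M : 'M[F]_n.+1)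
    (X : 'M[F]_(n.+1, k)) (us : seq F) (p : {poly F}) :
  uniq us ->
  horner_mx M (\prod_(z <- us) ('X - z%:P) * p) *m X = 0 ->
  (forall l, l \in us ->
     horner_mx M (\prod_(z <- us | z != l) ('X - z%:P) * p) *m X = 0) ->
  horner_mx M p *m X = 0.
Proof.
elim: us => [|a us IH]; first by rewrite big_nil mul1r.
move=> /= /andP[aus uus] _ H.
have neqa : \prod_(z <- us | z != a) ('X - z%:P) = \prod_(z <- us) ('X - z%:P).
  rewrite [LHS]big_seq_cond [RHS]big_seq_cond.
  apply: eq_bigl => z; case zus: (z \in us) => //=.
  by apply: contraNneq aus => <-.
apply: IH => // [|l lus].
  by have := H a (mem_head _ _); rewrite big_cons eqxx /= neqa.
have := H a (mem_head _ _); have := H l; rewrite inE lus orbT => /(_ isT).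
have al : a != l by apply: contraNneq aus => ->.
rewrite !big_cons eqxx al /= neqa (bigD1_seq l) //=.
set f := \prod_(z <- us | z != l) _ => H1 H2.
have : (l - a)%:P * (f * p) = ('X - a%:P) * f * p - ('X - l%:P) * f * p.
  by rewrite polyCB; ring.
move/(congr1 (fun q => horner_mx M q *m X)) => /=.
rewrite [in RHS]rmorphB /= mulmxBl H1 H2 subrr rmorphM /= horner_mx_C.
rewrite -mulmxE mul_scalar_mx -scalemxAl => /eqP.
by rewrite scaler_eq0 subr_eq0 eq_sym (negbTE al) /= => /eqP.
Qed.

Lemma horner_mx_eigen (F : fieldType) (n k : nat) (M : 'M[F]_n.+1)
    (V : 'M[F]_(k, n.+1)) (l : F) (p : {poly F}) :
  V *m M = l *: V -> V *m horner_mx M p = p.[l] *: V.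
Proof.
move=> VM; elim/poly_ind: p => [|p c IH].
  by rewrite rmorph0 mulmx0 horner0 scale0r.
rewrite rmorphD rmorphM /= horner_mx_C horner_mx_X mulmxDr mul_mx_scalar.
rewrite [X in V *m X]/(_ *m _) mulmxA IH -scalemxAl VM scalerA -scalerDl.
by rewrite hornerMXaddC.
Qed.

(** * Geometric decay and real rotation blocks *)

Section ComplexEntries.
Variable R : realType.
Local Notation C := R[i].

Lemma normcE (z : C) : `|z| = (Normc.normc z)%:C%C.
Proof. by case: z. Qed.

Lemma normc_ge0 (z : C) : 0 <= Normc.normc z.
Proof. by case: z => a b /=; exact: sqrtr_ge0. Qed.

Lemma toCM (p q r : nat) (M : 'M[R]_(p, q)) (N : 'M[R]_(q, r)) :
  toC (M *m N) = toC M *m toC N.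
Proof. exact: (@map_mxM _ _ (real_complex R)). Qed.

Lemma toC_eq0 (p q : nat) (M : 'M[R]_(p, q)) : (toC M == 0) = (M == 0).
Proof. exact: (@map_mx_eq0 _ _ (real_complex R)). Qed.

Lemma toC0 (p q : nat) : toC (0 : 'M[R]_(p, q)) = 0.
Proof. by apply/eqP; rewrite toC_eq0. Qed.

(** Writing M^(t+1) X = M^t (M - l) X + l M^t X gives a scalar recursion with factor |l| and a
    forcing term that already decays. *)
Lemma geometric_step (n k : nat) (M : 'M[C]_n.+1) (X : 'M[C]_(n.+1, k))
    (l : C) (c rho : R) :
  `|l| < 1 -> 0 < rho < 1 ->
  (forall t i j, Normc.normc
     ((M ^+ t *m (horner_mx M ('X - l%:P) *m X)) i j) <= c * rho ^+ t) ->
  exists c' rho', 0 < rho' < 1 /\ forall t i j,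
    Normc.normc ((M ^+ t *m X) i j) <= c' * rho' ^+ t.
Proof.
rewrite normcE -[1]/(1%:C%C) ltcR => l1 /andP[r0 r1] H.
set nl := Normc.normc l in l1 *; have nl0 : 0 <= nl := normc_ge0 l.
(* The midpoint between 1 and the larger of the two rates leaves a gap [r' - nl], in which [c']
   absorbs the forcing term. *)
pose r' := (1 + Num.max rho nl) / 2.
have [rr' lr' r'1] : [/\ rho <= r', nl < r' & r' < 1].
  by rewrite /r'; case: (leP rho nl) => ?; split; lra.
case: k => [|k] in X H *.
  by exists 0, r'; split=> [|t i []//]; apply/andP; split; lra.
have c0 : 0 <= c.
  by have := H 0 0 0; rewrite expr0 mulr1; apply: le_trans; exact: normc_ge0.
pose s := \sum_i \sum_j Normc.normc (X i j).
pose c' := s + c / (r' - nl).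
have cr0 : 0 <= c / (r' - nl) by rewrite divr_ge0 // subr_ge0 ltW.
exists c', r'; split; first by apply/andP; split; lra.
elim=> [|t IH] i j.
  rewrite expr0 mul1mx mulr1 /c' -[X in X <= _]addr0 lerD //.
  rewrite /s (bigD1 i) //= (bigD1 j) //= -addrA lerDl addr_ge0 //.
    by apply: sumr_ge0 => ? _; exact: normc_ge0.
  by apply: sumr_ge0 => ? _; apply: sumr_ge0 => ? _; exact: normc_ge0.
have E : (M ^+ t.+1 *m X) i j
    = (M ^+ t *m (horner_mx M ('X - l%:P) *m X)) i j + l * (M ^+ t *m X) i j.
  rewrite rmorphB /= horner_mx_X horner_mx_C mulmxBl mul_scalar_mx mulmxBr.
  rewrite -scalemxAr mulmxA -[M ^+ t *m M]/(M ^+ t * M) -exprSr.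
  by rewrite !mxE subrK.
rewrite E; apply: le_trans (le_normcD _ _) _.
rewrite Normc.normcM -/nl.
apply: le_trans (lerD (H t i j) (ler_wpM2l nl0 (IH i j))) _.
have -> : c' * r' ^+ t.+1 = (c' * (r' - nl)) * r' ^+ t + nl * (c' * r' ^+ t).
  by rewrite exprS; ring.
rewrite lerD2r; apply: (@le_trans _ _ (c * r' ^+ t)).
  by rewrite ler_wpM2l // lerXn2r ?nnegrE //; lra.
rewrite ler_wpM2r ?exprn_ge0 //; first by lra.
rewrite /c' mulrDl divfK; last by rewrite subr_eq0 gt_eqF.
rewrite lerDr mulr_ge0 ?subr_ge0 ?(ltW lr') //.
by apply: sumr_ge0 => ? _; apply: sumr_ge0 => ? _; exact: normc_ge0.
Qed.

Lemma geometric_decay (n k : nat) (M : 'M[C]_n.+1) (X : 'M[C]_(n.+1, k))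
    (ss : seq C) :
  all (fun z => `|z| < 1) ss ->
  horner_mx M (\prod_(z <- ss) ('X - z%:P)) *m X = 0 ->
  exists c rho : R, 0 < rho < 1 /\ forall t i j,
    Normc.normc ((M ^+ t *m X) i j) <= c * rho ^+ t.
Proof.
elim: ss X => [|l ss IH] X /=.
  rewrite big_nil rmorph1 mul1mx => _ ->; exists 0, (1 / 2); split.
    by apply/andP; split; lra.
  by move=> t i j; rewrite mulmx0 mxE mul0r Normc.normc0.
move=> /andP[l1 ss1]; rewrite big_cons mulrC rmorphM /=.
rewrite [X in X *m _]/(_ *m _) -mulmxA => /(IH _ ss1) [c [rho [r01 H]]].
exact: geometric_step l1 r01 H.
Qed.

(** [A] acts on each pair of rows of [P] and [Q] as the rotation by the unit complex number a + ib,
    which preserves the sum of the Gram matrices. *)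
Lemma rotation_gram (n k : nat) (A : 'M[R]_n) (P Q : 'M[R]_(k, n)) (a b : R) :
  a ^+ 2 + b ^+ 2 = 1 ->
  P *m A = a *: P - b *: Q -> Q *m A = a *: Q + b *: P ->
  (P *m A)^T *m (P *m A) + (Q *m A)^T *m (Q *m A) = P^T *m P + Q^T *m Q.
Proof.
move=> ab -> ->; apply/matrixP => i j; rewrite !mxE -!big_split /=.
apply: eq_bigr => l _; rewrite !mxE.
by rewrite -[RHS]mul1r -ab; ring.
Qed.

(** [Y] stacks the real and imaginary parts of all the [V l]; each pair is rotated by [A]. The
    annihilating polynomial with unit-modulus roots prepares the reachability argument. *)
Lemma real_invariant_rows (n : nat) (A : 'M[R]_n.+1) (us : seq C)
    (V : C -> 'M[C]_n.+1) :
  all (fun z => `|z| == 1) us ->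
  (forall l, l \in us -> V l *m toC A = l *: V l) ->
  exists (N : nat) (Y : 'M[R]_(N, n.+1)),
  [/\ (Y *m A)^T *m (Y *m A) = Y^T *m Y,
      forall k (X : 'M[R]_(n.+1, k)), Y *m X = 0 ->
        forall l, l \in us -> V l *m toC X = 0 &
      exists vs : seq C, all (fun z => `|z| == 1) vs /\
        toC Y *m horner_mx (toC A) (\prod_(z <- vs) ('X - z%:P)) = 0].
Proof.
elim: us => [|l us IH] /=.
  move=> _ _; exists 0%N, 0; split=> //; first by rewrite mul0mx.
  by exists [::]; split=> //; rewrite [toC 0]flatmx0 mul0mx.
move=> /andP[/eqP l1 us1] VA.
have [m mus|N [Y [YA YX [vs [vs1 Yvs]]]]] := IH us1.
  by apply: VA; rewrite inE mus orbT.
pose Vl := V l; have VlA : Vl *m toC A = l *: Vl by apply: VA; rewrite mem_head.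
pose P := map_mx (@complex.Re R) Vl; pose Q := map_mx (@complex.Im R) Vl.
pose VJ := map_mx (@conjc R) Vl.
have VJA : VJ *m toC A = l^*%C *: VJ.
  have := congr1 (map_mx (@conjc R)) VlA; rewrite map_mxM map_mxZ => <-.
  congr (_ *m _); apply/matrixP => i j; rewrite !mxE.
  by rewrite /= oppr0.
have PE : toC P = 2^-1 *: (Vl + VJ).
  apply/matrixP => i j; rewrite !mxE.
  by rewrite -[Complex _ 0]/((complex.Re (Vl i j))%:C%C) ReJ_add mulrC.
have QE : toC Q = (2^-1 * 'i%C) *: (VJ - Vl).
  apply/matrixP => i j; rewrite !mxE.
  rewrite -[Complex _ 0]/((complex.Im (Vl i j))%:C%C) ImJ_sub.
  by rewrite [RHS]mulrC mulrA.
have VlE : Vl = toC P + 'i%C *: toC Q.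
  apply/matrixP => i j; rewrite !mxE [LHS]complexE.
  by [].
have key i j : (P *m A) i j = complex.Re l * P i j - complex.Im l * Q i j /\
    (Q *m A) i j = complex.Re l * Q i j + complex.Im l * P i j.
  have : (toC (P *m A) + 'i%C *: toC (Q *m A)) i j = (l *: Vl) i j.
    by rewrite -VlA !toCM scalemxAl -mulmxDl -VlE.
  have tE (M : 'M[R]_n.+1) : (toC M) i j = Complex (M i j) 0 by rewrite mxE.
  have lE (M M2 : 'M[C]_n.+1) c : (M + c *: M2) i j = M i j + c * M2 i j.
    by rewrite !mxE.
  rewrite [in RHS]VlE lE [RHS]mxE lE !tE; case: (l) => a b /eqP.
  by rewrite eq_complex /= => /andP[/eqP e1 /eqP e2]; split; lra.
have PA : P *m A = complex.Re l *: P - complex.Im l *: Q.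
  by apply/matrixP => i j; rewrite (key i j).1 !mxE.
have QA : Q *m A = complex.Re l *: Q + complex.Im l *: P.
  by apply/matrixP => i j; rewrite (key i j).2 !mxE.
have l2 : complex.Re l ^+ 2 + complex.Im l ^+ 2 = 1.
  by apply: complexI; rewrite add_Re2_Im2 l1 expr1n.
exists (N + (n.+1 + n.+1))%N, (col_mx Y (col_mx P Q)); split.
- rewrite !mul_col_mx !tr_col_mx !mul_row_col YA.
  by rewrite (rotation_gram _ _ _ _ _ _ _ l2 PA QA).
- move=> k X; rewrite !mul_col_mx => /eqP; rewrite !col_mx_eq0.
  move=> /and3P[/eqP YX0 /eqP PX0 /eqP QX0] m; rewrite inE => /predU1P[->|].
    rewrite -/Vl VlE mulmxDl -scalemxAl -!toCM PX0 QX0.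
    by rewrite toC0 scaler0 addr0.
  exact: YX.
(* [P] and [Q] combine eigenrows for [l] with eigenrows for its conjugate, so both roots enter. *)
- exists (l :: l^*%C :: vs); split.
    rewrite /= l1 eqxx vs1 andbT /= normc_def.
    by case: (l) l1 => a b; rewrite normc_def /= sqrrN => ->.
  rewrite /toC !map_col_mx !mul_col_mx -/(toC Y) -/(toC P) -/(toC Q).
  set p := \prod_(z <- _) _.
  have Yp : toC Y *m horner_mx (toC A) p = 0.
    rewrite /p !big_cons mulrA mulrC rmorphM /=.
    by rewrite [X in _ *m X]/(_ *m _) mulmxA Yvs mul0mx.
  have Vp : Vl *m horner_mx (toC A) p = 0.
    rewrite (horner_mx_eigen _ _ _ _ _ _ _ VlA).
    by rewrite (rootP _) ?scale0r // root_prod_XsubC mem_head.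
  have VJp : VJ *m horner_mx (toC A) p = 0.
    rewrite (horner_mx_eigen _ _ _ _ _ _ _ VJA).
    by rewrite (rootP _) ?scale0r // root_prod_XsubC !inE eqxx orbT.
  rewrite Yp PE QE -!scalemxAl mulmxDl mulmxBl Vp VJp subrr addr0 !scaler0.
  by rewrite !col_mx0.
Qed.

End ComplexEntries.

(** * Marginal part, stable complement and deadbeat gains *)

Section LinearStructure.
Variable R : realType.
Local Notation C := R[i].

(** The diagonal entries of the sum are sums of squares of all entries in a row. *)
Lemma sum_gram_eq0 (k p q : nat) (M : 'I_k -> 'M[R]_(p, q)) :
  \sum_j M j *m (M j)^T = 0 -> forall j, M j = 0.
Proof.
move=> H j; apply/matrixP => a b; rewrite mxE.
have : \sum_j \sum_l M j a l ^+ 2 = 0.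
  have := congr1 (fun X : 'M[R]_p => X a a) H; rewrite mxE summxE => H'.
  rewrite -[RHS]H'; apply: eq_bigr => i _; rewrite mxE; apply: eq_bigr => l _.
  by rewrite mxE expr2.
have s0 i : 0 <= \sum_l M i a l ^+ 2 by apply: sumr_ge0 => l _; exact: sqr_ge0.
move=> /psumr_eq0P => /(_ (fun i _ => s0 i)) /(_ j isT).
move=> /psumr_eq0P => /(_ (fun i _ => sqr_ge0 _)) /(_ b isT) /eqP.
by rewrite sqrf_eq0 => /eqP.
Qed.

Lemma gram_eq0 (p q : nat) (M : 'M[R]_(p, q)) : M^T *m M = 0 -> M = 0.
Proof.
move=> H; have := @sum_gram_eq0 1 _ _ (fun=> M^T).
rewrite big_ord1 trmxK => /(_ H ord0) /(congr1 trmx).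
by rewrite trmxK trmx0.
Qed.

Lemma gram_mulmx (N n k : nat) (A : 'M[R]_n) (Y : 'M[R]_(N, n)) (W : 'M[R]_(n, k)) :
  (Y *m A)^T *m (Y *m A) = Y^T *m Y ->
  (Y *m A *m W)^T *m (Y *m A *m W) = (Y *m W)^T *m (Y *m W).
Proof.
move=> YA; transitivity (W^T *m ((Y *m A)^T *m (Y *m A)) *m W).
  by rewrite trmx_mul !mulmxA.
by rewrite YA trmx_mul !mulmxA.
Qed.

Lemma toCX (n : nat) (A : 'M[R]_n.+1) t : toC (A ^+ t) = toC A ^+ t.
Proof.
elim: t => [|t IH]; first exact: (map_mx1 (real_complex R)).
by rewrite !exprS -IH; exact: toCM.
Qed.

Lemma toCD (p q : nat) (M N : 'M[R]_(p, q)) : toC (M + N) = toC M + toC N.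
Proof. exact: (map_mxD (real_complex R)). Qed.

Lemma horner_mx_sum (F : fieldType) (n : nat) (M : 'M[F]_n.+1) (p : {poly F}) :
  horner_mx M p = \sum_(i < size p) p`_i *: M ^+ i.
Proof.
rewrite -[in LHS](coefK p) poly_def rmorph_sum; apply: eq_bigr => i _ /=.
by rewrite -mul_polyC rmorphM rmorphXn /= horner_mx_X horner_mx_C -mulmxE mul_scalar_mx.
Qed.

(** Hautus argument: once the roots are peeled off one by one, a nonzero row would be a left
    eigenvector of [A] for a unit-modulus [l] that annihilates [B], hence a left eigenvector of
    [A + B *m K] for the same [l]. *)
Lemma reachable_of_stabilizable (n m k : nat) (A : 'M[R]_n.+1)
    (B : 'M[R]_(n.+1, m)) (Z : 'M[R]_(k, n.+1)) (vs : seq C) :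
  stabilizable A B ->
  all (fun z => `|z| == 1) vs ->
  toC Z *m horner_mx (toC A) (\prod_(z <- vs) ('X - z%:P)) = 0 ->
  (forall j : 'I_n.+1, Z *m A ^+ j *m B = 0) -> Z = 0.
Proof.
move=> [K Kstab] vs1 Zvs ZB.
suff : toC Z = 0 by move/eqP; rewrite toC_eq0 => /eqP.
(* By Cayley-Hamilton only the remainder modulo the characteristic polynomial counts, and its degree
   is low enough for [ZB]. *)
have ZpB (p : {poly C}) : toC Z *m horner_mx (toC A) p *m toC B = 0.
  pose chi := char_poly (toC A).
  have chi_mon : chi \is monic := char_poly_monic _.
  rewrite (Pdiv.IdomainMonic.divp_eq chi_mon p) rmorphD rmorphM /=.
  rewrite Cayley_Hamilton mulr0 add0r horner_mx_sum mulmx_sumr mulmx_suml.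
  apply: big1 => i _.
  rewrite -scalemxAr -scalemxAl -toCX -!toCM.
  have iS : (i < n.+1)%N.
    apply: leq_trans (ltn_ord i) _; rewrite -ltnS -(size_char_poly (toC A)).
    by rewrite ltn_modpN0 // monic_neq0.
  by rewrite (ZB (Ordinal iS)) toC0 scaler0.
elim: vs vs1 (toC Z) Zvs ZpB => [_|l vs IH /= /andP[/eqP l1 vs1]] X XvS XpB.
  by move: XvS; rewrite big_nil rmorph1 mulmx1.
have Xl : X *m horner_mx (toC A) ('X - l%:P) = 0.
  apply: (IH vs1).
    by move: XvS; rewrite big_cons rmorphM /= -mulmxE mulmxA.
  move=> p; have := XpB (('X - l%:P) * p).
  by rewrite rmorphM /= -mulmxE !mulmxA.
have XA : X *m toC A = l *: X.
  by move/eqP: Xl; rewrite rmorphB /= horner_mx_X horner_mx_C mulmxBr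
    mul_mx_scalar subr_eq0 => /eqP.
have XB : X *m toC B = 0 by have := XpB 1; rewrite rmorph1 mulmx1.
apply/eqP; rewrite -nz_row_eq0; apply/negPn/negP => v0.
have /submxP[D vE] := nz_row_sub X.
suff /Kstab : eigenvalue (toC (A + B *m K)) l by rewrite l1 ltxx.
apply/eigenvalueP; exists (nz_row X) => //.
by rewrite vE toCD toCM mulmxDr -!mulmxA XA (mulmxA X) XB mul0mx mulmx0 addr0 scalemxAr.
Qed.

(** [Y] isolates the marginally stable part, the output injection [L] leaves exponentially decaying
    dynamics, and the gains [G j] form a deadbeat control of Y x over [n.+1] steps. *)
Lemma linear_structure (n m : nat) (A : 'M[R]_n.+1) (B : 'M[R]_(n.+1, m)) :
  (forall l : C, eigenvalue (toC A) l -> `|l| <= 1) ->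
  (forall l : C, eigenvalue (toC A) l -> `|l| = 1 ->
      mup l (char_poly (toC A)) = \rank (eigenspace (toC A) l)) ->
  stabilizable A B ->
  exists (N : nat) (Y : 'M[R]_(N, n.+1)) (L : 'M[R]_(n.+1, N))
    (G : nat -> 'M[R]_(m, N)) (c rho : R),
  [/\ (Y *m A)^T *m (Y *m A) = Y^T *m Y,
      0 < rho < 1,
      forall t i j, `|((A - L *m Y) ^+ t) i j| <= c * rho ^+ t &
      Y *m (\sum_(j < n.+1) A ^+ j *m B *m G j) *m Y = Y *m A ^+ n.+1].
Proof.
move=> le1 semi stab.
have [us [ss [uus us1 ss1 ann]]] := annihilator_split _ _ _ le1 semi.
set pu := \prod_(z <- us) _ in ann; set ps := \prod_(z <- ss) _ in ann.
(* The annihilator with the factor of [l] removed, evaluated at [A]: restoring the factor gives 0,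
   which is the eigenvector equation for the rows. *)
pose V l := horner_mx (toC A) (\prod_(z <- us | z != l) ('X - z%:P) * ps).
have VA l : l \in us -> V l *m toC A = l *: V l.
  move=> lus; apply/eqP; rewrite -subr_eq0 -mul_mx_scalar -mulmxBr.
  have -> : toC A - l%:M = horner_mx (toC A) ('X - l%:P).
    by rewrite rmorphB /= horner_mx_X horner_mx_C.
  rewrite mulmxE -rmorphM /= -[X in _ == X]ann; apply/eqP; congr (horner_mx _ _).
  by rewrite /pu (bigD1_seq l) //=; ring.
have [N [Y [YA YX [vs [vs1 Yvs]]]]] := real_invariant_rows _ _ _ _ V us1 VA.
have [Yg YgE] : exists Yg, Y *m Yg *m Y = Y.
  by exists (pinvmx Y); rewrite mulmxKpV.
(* [P] is a projection with the same kernel as [Y], and [Q] projects onto that kernel. *)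
pose P := Yg *m Y; pose Q := 1%:M - P.
have YP : Y *m P = Y by rewrite mulmxA.
have YQ : Y *m Q = 0 by rewrite mulmxBr mulmx1 YP subrr.
(* [A] maps the kernel of [Y] into itself because it preserves the seminorm |Y x|. *)
have YAt t : Y *m A ^+ t *m Q = 0.
  elim: t => [|t IH]; first by rewrite expr0 mulmx1 YQ.
  apply: gram_eq0; rewrite exprS -mulmxE.
  have -> : Y *m (A *m A ^+ t) *m Q = Y *m A *m (A ^+ t *m Q) by rewrite !mulmxA.
  by rewrite (gram_mulmx _ _ _ _ _ _ YA) (mulmxA Y) IH mulmx0.
have PAt t : P *m (A ^+ t *m Q) = 0.
  by rewrite /P -mulmxA (mulmxA Y) YAt mulmx0.
(* With the injection A Yg the matrix becomes A Q, and invariance of the image of [Q] collapses its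
   powers. *)
have FE t : (A - A *m Yg *m Y) ^+ t.+1 = A ^+ t.+1 *m Q.
  have F1 : A - A *m Yg *m Y = A *m Q by rewrite /Q /P mulmxBr mulmx1 mulmxA.
  rewrite F1; elim: t => [|t IH]; first by rewrite !expr1.
  rewrite exprS IH [in RHS]exprS -!mulmxE -!mulmxA; congr (A *m _).
  by rewrite {1}/Q mulmxBl mul1mx PAt subr0.
(* All [V l] vanish on the image of [Q], so the unit-modulus factors can be eliminated from the
   annihilator and only roots in the open disk remain. *)
have [c [rho [r01 dec]]] : exists c rho : R, 0 < rho < 1 /\ forall t i j,
    Normc.normc ((toC A ^+ t *m toC Q) i j) <= c * rho ^+ t.
  apply: (geometric_decay _ _ _ _ _ _ ss1); apply: (horner_eliminate _ _ _ _ _ us) => //.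
    by rewrite ann mul0mx.
  by move=> l lus; apply: YX.
have dec' t i j : `|(A ^+ t *m Q) i j| <= c * rho ^+ t.
  by have := dec t i j; rewrite -toCX -toCM mxE /= expr0n addr0 sqrtr_sqr.
have c0 : 0 <= c.
  by have := dec' 0 ord0 ord0; rewrite expr0 mulr1; apply: le_trans.
(* The controllability Gramian over [n.+1] steps. If Y Wc Y^T K = 0, then K^T Y annihilates every
   A^j B and is 0 by reachability; hence [Y] factors through Y Wc Y^T. *)
pose Wc := \sum_(j < n.+1) A ^+ j *m B *m (A ^+ j *m B)^T.
have [X' YE] : exists X', Y = Y *m Wc *m Y^T *m X'.
  have sym : (Y *m Wc *m Y^T)^T = Y *m Wc *m Y^T.
    rewrite !trmx_mul trmxK mulmxA; congr (_ *m _ *m _).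
    rewrite /Wc raddf_sum; apply: eq_bigr => j _.
    by rewrite /= trmx_mul trmxK.
  suff /submxP[D YD] : (Y^T <= Y *m Wc *m Y^T)%MS.
    by exists D^T; apply: trmx_inj; rewrite trmx_mul trmxK sym -YD.
  rewrite submxE; move: (cokermx _) (mulmx_coker (Y *m Wc *m Y^T)) => K SK.
  suff KY : K^T *m Y = 0 by rewrite -[Y^T *m K]trmxK trmx_mul trmxK KY trmx0.
  apply: (reachable_of_stabilizable _ _ _ _ _ _ _ stab vs1).
    by rewrite toCM -mulmxA Yvs mulmx0.
  move=> j; rewrite -mulmxA.
  apply: (@sum_gram_eq0 n.+1 _ _ (fun j => K^T *m Y *m (A ^+ j *m B))).
  transitivity (K^T *m (Y *m Wc *m Y^T *m K)); last by rewrite SK mulmx0.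
  rewrite /Wc !(mulmx_sumr, mulmx_suml).
  by apply: eq_bigr => i _; rewrite !trmx_mul trmxK !mulmxA.
(* The gains are the steering inputs read off from the Gramian. The 1 in c + 1 covers t = 0, where
   the power is the identity and not [Q]. *)
exists N, Y, (A *m Yg),
  (fun j => (A ^+ j *m B)^T *m Y^T *m X' *m A ^+ n.+1 *m Yg), (c + 1), rho.
split=> //.
- move=> t i j; case: t => [|t].
    rewrite !expr0 mulr1 mxE; case: (i == j); rewrite ?normr1 ?normr0; lra.
  rewrite FE; apply: le_trans (dec' _ _ _) _.
  by rewrite ler_wpM2r ?lerDl // exprn_ge0 //; move/andP: r01 => [/ltW].
- rewrite [LHS](_ : _ = Y *m Wc *m Y^T *m X' *m A ^+ n.+1 *m P); last first.
    rewrite /Wc !(mulmx_sumr, mulmx_suml); apply: eq_bigr => i _.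
    by rewrite !mulmxA.
  rewrite -YE; apply/eqP; rewrite -subr_eq0 -oppr_eq0 opprB.
  by rewrite -{1}(mulmx1 (Y *m _)) -mulmxBr YAt.
Qed.

End LinearStructure.

(** * Euclidean norm and Lyapunov functions *)

Section EuclideanNorm.
Context {R : realType}.

Definition sqn {n : nat} (v : 'cV[R]_n) : R := \sum_(i < n) v i 0 ^+ 2.
Definition dotv {n : nat} (u v : 'cV[R]_n) : R := \sum_(i < n) u i 0 * v i 0.
Definition frob {p q : nat} (M : 'M[R]_(p, q)) : R :=
  Num.sqrt (\sum_i \sum_j M i j ^+ 2).

Lemma sqn_ge0 {n} (v : 'cV[R]_n) : 0 <= sqn v.
Proof. by apply: sumr_ge0 => i _; exact: sqr_ge0. Qed.

Lemma enorm_ge0 {n} (v : 'cV[R]_n) : 0 <= enorm v.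
Proof. exact: sqrtr_ge0. Qed.

Lemma frob_ge0 {p q} (M : 'M[R]_(p, q)) : 0 <= frob M.
Proof. exact: sqrtr_ge0. Qed.

Lemma enorm_sqr {n} (v : 'cV[R]_n) : enorm v ^+ 2 = sqn v.
Proof. by rewrite sqr_sqrtr // sqn_ge0. Qed.

Lemma enorm0 n : enorm (0 : 'cV[R]_n) = 0.
Proof. by rewrite /enorm big1 ?sqrtr0 // => i _; rewrite mxE expr0n. Qed.

Lemma enorm_eq0 {n} (v : 'cV[R]_n) : enorm v = 0 -> v = 0.
Proof.
move=> v0; have : sqn v = 0 by rewrite -enorm_sqr v0 expr0n.
move=> /psumr_eq0P => /(_ (fun i _ => sqr_ge0 _)) H.
apply/matrixP => i j; rewrite ord1 mxE; apply/eqP.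
by rewrite -sqrf_eq0; apply/eqP/H.
Qed.

Lemma enormZ {n} a (v : 'cV[R]_n) : enorm (a *: v) = `|a| * enorm v.
Proof.
rewrite -sqrtr_sqr /enorm -sqrtrM ?sqr_ge0 // mulr_sumr; congr Num.sqrt.
by apply: eq_bigr => i _; rewrite mxE exprMn.
Qed.

Lemma sqnD {n} (u v : 'cV[R]_n) : sqn (u + v) = sqn u + (2 * dotv u v + sqn v).
Proof.
rewrite /sqn /dotv mulr_sumr -!big_split /=; apply: eq_bigr => i _.
by rewrite mxE; ring.
Qed.

(** Cauchy-Schwarz, from the squared norm of |u|^2 v - (u.v) u when [u] is nonzero. *)
Lemma dotv_sqr_le {n} (u v : 'cV[R]_n) : dotv u v ^+ 2 <= sqn u * sqn v.
Proof.
have [u0|u0] := eqVneq (sqn u) 0.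
  move: u0 => /psumr_eq0P => /(_ (fun i _ => sqr_ge0 _)) H.
  rewrite /dotv big1 ?expr0n ?mulr_ge0 ?sqn_ge0 // => i _.
  by have /eqP := H i isT; rewrite sqrf_eq0 => /eqP ->; rewrite mul0r.
have u1 : 0 < sqn u by rewrite lt_neqAle eq_sym u0 sqn_ge0.
have : 0 <= \sum_i (sqn u * v i 0 - dotv u v * u i 0) ^+ 2.
  by apply: sumr_ge0 => i _; exact: sqr_ge0.
have gen (a c : R) : \sum_i (a * v i 0 - c * u i 0) ^+ 2
    = a ^+ 2 * sqn v - 2 * a * c * dotv u v + c ^+ 2 * sqn u.
  rewrite /sqn /dotv !mulr_sumr -sumrB -big_split /=.
  by apply: eq_bigr => i _; ring.
have -> : \sum_i (sqn u * v i 0 - dotv u v * u i 0) ^+ 2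
    = sqn u * (sqn u * sqn v - dotv u v ^+ 2).
  by rewrite gen; ring.
by rewrite pmulr_rge0 // subr_ge0.
Qed.

Lemma dotv_le {n} (u v : 'cV[R]_n) : dotv u v <= enorm u * enorm v.
Proof.
have [d0|d0] := leP (dotv u v) 0.
  by apply: le_trans d0 _; rewrite mulr_ge0 ?enorm_ge0.
rewrite -(@ler_pXn2r _ 2) ?nnegrE ?mulr_ge0 ?enorm_ge0 ?(ltW d0) //.
by rewrite exprMn !enorm_sqr dotv_sqr_le.
Qed.

Lemma enormD {n} (u v : 'cV[R]_n) : enorm (u + v) <= enorm u + enorm v.
Proof.
rewrite -(@ler_pXn2r _ 2) ?nnegrE ?addr_ge0 ?enorm_ge0 //.
rewrite enorm_sqr sqnD sqrrD !enorm_sqr -addrA lerD2l lerD2r.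
by have := dotv_le u v; lra.
Qed.

Lemma enorm_mulmx {p q} (M : 'M[R]_(p, q)) v : enorm (M *m v) <= frob M * enorm v.
Proof.
rewrite /frob /enorm -sqrtrM; last first.
  by apply: sumr_ge0 => i _; apply: sumr_ge0 => j _; exact: sqr_ge0.
apply: ler_wsqrtr; rewrite mulr_suml; apply: ler_sum => i _.
have := dotv_sqr_le (\col_j M i j) v; rewrite /sqn.
rewrite (eq_bigr (fun j => M i j ^+ 2)); last by move=> j _; rewrite mxE.
apply: le_trans; rewrite le_eqVlt; apply/orP; left; apply/eqP; congr (_ ^+ 2).
by rewrite mxE; apply: eq_bigr => j _; rewrite mxE.
Qed.

Lemma sqn_mulmx {p q} (M : 'M[R]_(p, q)) v : sqn (M *m v) <= frob M ^+ 2 * sqn v.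
Proof.
rewrite -!enorm_sqr -exprMn lerXn2r ?nnegrE ?mulr_ge0 ?enorm_ge0 ?frob_ge0 //.
exact: enorm_mulmx.
Qed.

Lemma sqn_trmx {n} (v : 'cV[R]_n) : sqn v = (v^T *m v) 0 0.
Proof. by rewrite mxE; apply: eq_bigr => i _; rewrite mxE expr2. Qed.

Lemma sqnD_le {n} (u v : 'cV[R]_n) : sqn (u + v) <= 2 * sqn u + 2 * sqn v.
Proof.
rewrite /sqn !mulr_sumr -big_split /=; apply: ler_sum => i _; rewrite mxE.
by have := sqr_ge0 (u i 0 - v i 0); nra.
Qed.

Lemma eq_ler (a b : R) : a = b -> a <= b.
Proof. by move=> ->. Qed.

Lemma le_add1_sqr (a : R) : a <= 1 + a ^+ 2.
Proof. by have := sqr_ge0 (a - 1); nra. Qed.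

Lemma norm_le_add1_sqr (a : R) : `|a| <= 1 + a ^+ 2.
Proof. by apply: le_trans (le_add1_sqr _) _; rewrite real_normK ?num_real. Qed.

Lemma entry_sqr_le k (v : 'cV[R]_k) i : v i 0 ^+ 2 <= sqn v.
Proof. by rewrite /sqn (bigD1 i) //= lerDl sumr_ge0 // => j _; exact: sqr_ge0. Qed.

Lemma sqn_affine_le k (v1 v2 v3 : 'cV[R]_k) :
  sqn (v1 + v2 + v3) <= 4 * sqn v1 + 4 * sqn v2 + 2 * sqn v3.
Proof.
apply: le_trans (sqnD_le _ _) _.
by have := sqnD_le v1 v2; lra.
Qed.

Lemma sqr_sum_le k (a : 'I_k -> R) : (\sum_i a i) ^+ 2 <= k%:R * \sum_i a i ^+ 2.
Proof.
pose e := \col_(j < k) (1 : R); pose f := \col_j a j.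
have -> : \sum_i a i = dotv e f by apply: eq_bigr => j _; rewrite !mxE mul1r.
have <- : sqn e = k%:R.
  rewrite -[in RHS](card_ord k) -sumr_const.
  by apply: eq_bigr => j _; rewrite mxE expr1n.
have -> : \sum_i a i ^+ 2 = sqn f by apply: eq_bigr => j _; rewrite mxE.
exact: dotv_sqr_le.
Qed.

Lemma sqn_sum_le {n k} (v : 'I_k -> 'cV[R]_n) :
  sqn (\sum_i v i) <= k%:R * \sum_i sqn (v i).
Proof.
rewrite /sqn [X in _ <= _ * X]exchange_big /= mulr_sumr; apply: ler_sum => i _.
by rewrite summxE; exact: sqr_sum_le.
Qed.

End EuclideanNorm.

(** * Time-dependent Lyapunov functions *)

Section Lyapunov.
Context {R : realType}.

(** [u] stands for a squared norm |y|^2. The function is of order |y|^4 / k^2 for |y| well below [k]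
    and close to |y|^2 far above [k]. *)
Definition lyap (k u : R) : R := u ^+ 2 / (u + k ^+ 2).

(** [s] is the norm after an unperturbed saturated step and s + 1 the norm before it. Raising [k]
    together with the norm leaves a cubic surplus, which later pays for the noise variance. *)
Lemma lyap_drift (s k : R) : 0 <= s -> 0 < k ->
  lyap k (s ^+ 2) + s ^+ 3 / (s ^+ 2 + k ^+ 2) <= lyap (k + 1) ((s + 1) ^+ 2).
Proof.
move=> s0 k0; rewrite /lyap -mulrDl.
have D0 : 0 < s ^+ 2 + k ^+ 2 by nra.
have E0 : 0 < (s + 1) ^+ 2 + (k + 1) ^+ 2 by nra.
rewrite ler_pdivrMr // mulrAC ler_pdivlMr // -subr_ge0.
(* After cross-multiplication the difference is a polynomial with visibly nonnegative terms. *)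
have -> : ((s + 1) ^+ 2) ^+ 2 * (s ^+ 2 + k ^+ 2)
    - ((s ^+ 2) ^+ 2 + s ^+ 3) * ((s + 1) ^+ 2 + (k + 1) ^+ 2)
  = (s + 1) * (s ^+ 2 * (s - k) ^+ 2 + s ^+ 3 + s ^+ 2 + 2 * k ^+ 2 * s ^+ 2
               + 3 * k ^+ 2 * s + k ^+ 2).
  by ring.
have t1 : 0 <= s ^+ 2 * (s - k) ^+ 2 by apply: mulr_ge0; exact: sqr_ge0.
have t2 : 0 <= s ^+ 3 by exact: exprn_ge0.
have t3 : 0 <= k ^+ 2 * s ^+ 2 by apply: mulr_ge0; exact: sqr_ge0.
have t4 : 0 <= k ^+ 2 * s by apply: mulr_ge0 => //; exact: sqr_ge0.
have t5 := sqr_ge0 s; have t6 := sqr_ge0 k.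
by apply: mulr_ge0; lra.
Qed.

Lemma lyap_ge0 (k u : R) : 0 <= u -> 0 <= lyap k u.
Proof. by move=> u0; rewrite /lyap divr_ge0 ?sqr_ge0 ?addr_ge0 ?sqr_ge0. Qed.

Lemma lyap_le (k u : R) : 0 <= u -> lyap k u <= u.
Proof.
move=> u0; rewrite /lyap; have [->|u1] := eqVneq u 0; first by rewrite expr0n mul0r.
have u2 : 0 < u by rewrite lt_neqAle eq_sym u1.
by rewrite ler_pdivrMr ?ltr_wpDr ?sqr_ge0 //; have := sqr_ge0 k; nra.
Qed.

Lemma lyap1_ge (u : R) : 0 <= u -> u - 1 <= lyap 1 u.
Proof. by move=> u0; rewrite /lyap ler_pdivlMr ?expr1n; nra. Qed.

(* Taylor expansion of [lyap k] at [sqn p], whose second derivative is at most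
   2 k^4 / (u + k^2)^3. *)
Lemma lyap_noise {N : nat} (p v : 'cV[R]_N) {k D : R} : 0 < k -> D = sqn p + k ^+ 2 ->
  lyap k (sqn (p + v)) <= lyap k (sqn p)
    + (sqn p ^+ 2 + 2 * sqn p * k ^+ 2) / D ^+ 2 * (2 * dotv p v)
    + 10 * (sqn p / D) * sqn v + 2 / k ^+ 2 * sqn v ^+ 2.
Proof.
move=> k0 DE; rewrite DE {DE D}.
have := dotv_sqr_le p v; have := sqn_ge0 (p + v); rewrite sqnD.
move: (dotv p v) => x; have := sqn_ge0 p; have := sqn_ge0 v.
move: (sqn p) (sqn v) => s n n0 s0 q0 CS.
set K := k ^+ 2; have K0 : 0 < K by rewrite /K exprn_gt0.
set D := s + K; have D0 : 0 < D by rewrite /D; lra.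
set d := 2 * x + n in q0 *; set q := s + d in q0 *.
have qK : 0 < q + K by lra.
have Dn : D != 0 by exact: lt0r_neq0.
have Kn : K != 0 by exact: lt0r_neq0.
(* The second-order expansion of u^2 / (u + K) at [s], with its exact remainder. *)
have taylor : lyap k q = lyap k s + (s ^+ 2 + 2 * s * K) / D ^+ 2 * d
    + K ^+ 2 * d ^+ 2 / (D ^+ 2 * (q + K)).
  have gen (a b c : R) : a + c != 0 -> a + b + c != 0 ->
      (a + b) ^+ 2 / (a + b + c) = a ^+ 2 / (a + c)
      + (a ^+ 2 + 2 * a * c) / (a + c) ^+ 2 * b
      + c ^+ 2 * b ^+ 2 / ((a + c) ^+ 2 * (a + b + c)).
    by move=> h1 h2; field; rewrite h1 h2.
  by apply: gen; apply: lt0r_neq0.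
rewrite taylor.
have d2 : d ^+ 2 <= 8 * (s * n) + 2 * n ^+ 2.
  by rewrite /d; have := sqr_ge0 (2 * x - n); nra.
have r1 : K ^+ 2 * d ^+ 2 / (D ^+ 2 * (q + K)) <= K * d ^+ 2 / D ^+ 2.
  rewrite ler_pdivrMr ?mulr_gt0 ?exprn_gt0 //.
  rewrite -[X in _ <= X]mulrA mulrA.
  rewrite [X in _ <= X](_ : _ = K * d ^+ 2 * (q + K)); last first.
    by field; exact: lt0r_neq0.
  by have := mulr_ge0 (mulr_ge0 (ltW K0) (sqr_ge0 d)) q0; lra.
have r2 : K * d ^+ 2 / D ^+ 2 <= 8 * (s / D) * n + 2 / K * n ^+ 2.
  apply: (@le_trans _ _ (K * (8 * (s * n) + 2 * n ^+ 2) / D ^+ 2)).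
    by rewrite ler_wpM2r ?invr_ge0 ?exprn_ge0 ?(ltW D0) // ler_wpM2l // ltW.
  have -> : 8 * (s / D) * n + 2 / K * n ^+ 2
    = (8 * s * n * D + 2 / K * n ^+ 2 * D ^+ 2) / D ^+ 2.
    by field; rewrite Dn Kn.
  rewrite ler_wpM2r ?invr_ge0 ?exprn_ge0 ?(ltW D0) //.
  rewrite mulrDr lerD //.
    by have := mulr_ge0 s0 (mulr_ge0 s0 n0); rewrite /D; lra.
  have -> : 2 / K * n ^+ 2 * D ^+ 2 = 2 * n ^+ 2 * (D ^+ 2 / K) by ring.
  have -> : K * (2 * n ^+ 2) = 2 * n ^+ 2 * K by ring.
  rewrite ler_wpM2l ?mulr_ge0 ?sqr_ge0 // ler_pdivlMr // -expr2.
  by rewrite lerXn2r ?nnegrE ?(ltW D0) ?(ltW K0) // /D; lra.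
(* The coefficient 10 of the statement is 8 from [r2] plus 2 from the part [n] of the increment [d]
   in the first-order term. *)
have r3 : (s ^+ 2 + 2 * s * K) / D ^+ 2 * n <= 2 * (s / D) * n.
  rewrite ler_wpM2r // ler_pdivrMr ?exprn_gt0 //.
  have -> : 2 * (s / D) * D ^+ 2 = 2 * s * D by field; exact: lt0r_neq0.
  by rewrite /D; nra.
rewrite {1}/d mulrDr; lra.
Qed.

(** [b] is the norm before the step: for b > 1 the drift bound applies with s = b - 1, and otherwise
    [p] vanishes. The term linear in [v] is kept explicit because only its expectation vanishes. *)
Lemma lyap_step {N : nat} (p v : 'cV[R]_N) (b k D : R) : 0 < k -> 0 <= b ->
  enorm p = Num.max 0 (b - 1) -> D = sqn p + k ^+ 2 ->
  lyap k (sqn (p + v)) <= lyap (k + 1) (b ^+ 2) - enorm p ^+ 3 / D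
    + (sqn p ^+ 2 + 2 * sqn p * k ^+ 2) / D ^+ 2 * (2 * dotv p v)
    + 10 * (sqn p / D) * sqn v + 2 / k ^+ 2 * sqn v ^+ 2.
Proof.
move=> k0 b0 pE DE; apply: le_trans (lyap_noise p v k0 DE) _.
rewrite !lerD2r lerBrDr -enorm_sqr.
have D0 : 0 < D by rewrite DE ltr_wpDl ?sqn_ge0 ?exprn_gt0.
have [b1|b1] := leP b 1.
  have -> : enorm p = 0 by rewrite pE; apply/max_idPl; lra.
  rewrite /lyap !expr0n /= !mul0r addr0; apply: lyap_ge0; exact: sqr_ge0.
have e1 : enorm p = b - 1 by rewrite pE; apply/max_idPr; lra.
have := lyap_drift (enorm p) k (enorm_ge0 _) k0.
by rewrite [in X in _ <= X -> _]e1 subrK DE -enorm_sqr.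
Qed.

(** The cubic surplus beats the quadratic noise term for s >= c, and below c the quadratic term is
    at most c^3. *)
Lemma cubic_le (c s : R) : 0 <= c -> 0 <= s -> c * s ^+ 2 - s ^+ 3 <= c ^+ 3.
Proof.
move=> c0 s0; have [cs|cs] := leP c s.
  apply: (@le_trans _ _ 0); last by rewrite exprn_ge0.
  by rewrite subr_le0 [s ^+ 3]exprS ler_wpM2r ?sqr_ge0.
apply: (@le_trans _ _ (c * s ^+ 2)); first by rewrite gerBl exprn_ge0.
by rewrite [c ^+ 3]exprS ler_wpM2l // lerXn2r ?nnegrE // ltW.
Qed.

End Lyapunov.

(** * The closed loop *)

Section Iteration.
Context {R : realType} {n : nat}.

Lemma affine_iter (A : 'M[R]_n.+1) (x v : nat -> 'cV[R]_n.+1) (k : nat) :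
  (forall j, (j < k)%N -> x j.+1 = A *m x j + v j) ->
  forall j, (j <= k)%N ->
  x j = A ^+ j *m x 0%N + \sum_(i < j) A ^+ (j - i.+1) *m v i.
Proof.
move=> H; elim=> [|j IH] jk; first by rewrite expr0 mul1mx big_ord0 addr0.
rewrite H // IH ?(ltnW jk) // big_ord_recr /= subnn expr0 mul1mx addrA.
rewrite mulmxDr mulmxA -[A *m A ^+ j]/(A * A ^+ j) -exprS mulmx_sumr.
congr (_ + _ + _); apply: eq_bigr => i _.
by rewrite mulmxA -[A *m _]/(A * A ^+ _) -exprS subSS subnSK.
Qed.

(** This is rho^t a0 plus the sum of rho^(t-1-i) g(i) over i < t; the recursive form suits both
    pathwise estimates and expectations. *)
Definition geom_majorant (rho a0 : R) (g : nat -> R) : nat -> R :=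
  fix f t := if t is t'.+1 then rho * f t' + g t' else a0.

Lemma frob_geometric (F : 'M[R]_n.+1) (c rho : R) : 0 <= rho ->
  (forall t i j, `|(F ^+ t) i j| <= c * rho ^+ t) ->
  forall t, frob (F ^+ t) <= n.+1%:R * c * rho ^+ t.
Proof.
move=> r0 H t.
have c0 : 0 <= c.
  by have := H 0%N 0 0; rewrite expr0 mulr1; apply: le_trans.
have cr0 : 0 <= c * rho ^+ t by rewrite mulr_ge0 // exprn_ge0.
have -> : n.+1%:R * c * rho ^+ t = Num.sqrt ((n.+1%:R * (c * rho ^+ t)) ^+ 2).
  by rewrite sqrtr_sqr ger0_norm ?mulrA // -mulrA mulr_ge0.
apply: ler_wsqrtr.
apply: (@le_trans _ _ (\sum_(i < n.+1) \sum_(j < n.+1) (c * rho ^+ t) ^+ 2)).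
  apply: ler_sum => i _; apply: ler_sum => j _.
  by rewrite -real_normK ?num_real // lerXn2r ?nnegrE.
rewrite !sumr_const !card_ord -mulrnA [X in _ <= X]exprMn [X in _ <= X * _]expr2.
by rewrite -[in X in _ <= X]natrM mulr_natl.
Qed.

Lemma stable_majorant (F : 'M[R]_n.+1) (c rho : R) : 0 <= rho ->
  (forall t i j, `|(F ^+ t) i j| <= c * rho ^+ t) ->
  forall (x e : nat -> 'cV[R]_n.+1), (forall t, x t.+1 = F *m x t + e t) ->
  forall t, enorm (x t) <=
    n.+1%:R * c * geom_majorant rho (enorm (x 0%N)) (fun t => enorm (e t)) t.
Proof.
move=> r0 H x e xE t; set a := geom_majorant _ _ _.
have fF := frob_geometric F c rho r0 H.
(* The extra power of [F] lets the induction trade a time step for a power, so that the constant is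
   not compounded. *)
suff : forall k, enorm (F ^+ k *m x t) <= n.+1%:R * c * rho ^+ k * a t.
  by move=> /(_ 0%N); rewrite expr0 mul1mx mulr1.
elim: t => [|t IH] k /=.
  apply: le_trans (enorm_mulmx _ _) _.
  by rewrite ler_wpM2r ?enorm_ge0.
rewrite xE mulmxDr mulmxA -[F ^+ k *m F]/(F ^+ k * F) -exprSr.
apply: le_trans (enormD _ _) _.
rewrite mulrDr lerD //.
  by apply: le_trans (IH k.+1) _; rewrite exprSr !mulrA.
apply: le_trans (enorm_mulmx _ _) _.
by rewrite ler_wpM2r ?enorm_ge0.
Qed.

End Iteration.

Section ClosedLoop.
Context {R : realType} {n m N : nat}.
Context (A : 'M[R]_n.+1) (B : 'M[R]_(n.+1, m)) (Y : 'M[R]_(N, n.+1))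
  (L : 'M[R]_(n.+1, N)) (G : nat -> 'M[R]_(m, N)) (c rho : R).
Hypothesis YA : (Y *m A)^T *m (Y *m A) = Y^T *m Y.
Hypothesis rho01 : 0 < rho < 1.
Hypothesis Fdecay :
  forall t i j, `|((A - L *m Y) ^+ t) i j| <= c * rho ^+ t.
Hypothesis YG :
  Y *m (\sum_(j < n.+1) A ^+ j *m B *m G j) *m Y = Y *m A ^+ n.+1.

Definition sat (y : 'cV[R]_N) : R := (Num.max 1 (enorm y))^-1.

(* At time t = q (n+1) + j the state x_{q(n+1)} that starts the current block
   is column j of the history. *)
Definition policy (t : nat) (H : 'M[R]_(n.+1, n.+1)) : 'cV[R]_m :=
  let y := Y *m col (inord (t %% n.+1)) H in
  - (sat y *: (G (n - t %% n.+1) *m y)).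

Lemma max1_gt0 (a : R) : 0 < Num.max 1 a.
Proof. by rewrite lt_max ltr01. Qed.

Lemma sat_ge0 y : 0 <= sat y.
Proof. by rewrite invr_ge0 ltW // max1_gt0. Qed.

Lemma sat_le1 y : sat y <= 1.
Proof. by rewrite invf_le1 ?max1_gt0 // le_max lexx. Qed.

Lemma sat_enorm y : sat y * enorm y <= 1.
Proof. by rewrite mulrC ler_pdivrMr ?max1_gt0 // mul1r le_max lexx orbT. Qed.

Lemma enorm_input y j : (j < n.+1)%N ->
  enorm (sat y *: (G j *m y)) <= \sum_(i < n.+1) frob (G i).
Proof.
move=> jn; rewrite enormZ ger0_norm ?sat_ge0 //.
apply: (@le_trans _ _ (frob (G j))); last first.
  rewrite (bigD1 (Ordinal jn)) //= lerDl sumr_ge0 // => i _; exact: frob_ge0.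
apply: le_trans (ler_wpM2l (sat_ge0 _) (enorm_mulmx _ _)) _.
rewrite mulrCA -[X in _ <= X]mulr1 ler_wpM2l ?frob_ge0 //; exact: sat_enorm.
Qed.

Lemma enorm_policy t H : enorm (policy t H) <= \sum_(i < n.+1) frob (G i).
Proof.
rewrite /policy -scaleN1r enormZ normrN1 mul1r; apply: enorm_input.
by rewrite ltnS leq_subr.
Qed.

Lemma enorm_YA t v : enorm (Y *m A ^+ t *m v) = enorm (Y *m v).
Proof.
rewrite /enorm; congr Num.sqrt; rewrite -!/(sqn _).
elim: t v => [|t IH] v; first by rewrite expr0 mulmx1.
rewrite exprSr -mulmxE.
have -> : Y *m (A ^+ t *m A) *m v = Y *m A ^+ t *m (A *m v) by rewrite !mulmxA.
by rewrite IH mulmxA !sqn_trmx (gram_mulmx _ _ _ _ _ _ _ YA).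
Qed.

Section Trajectory.
Context (w : nat -> 'cV[R]_n.+1) (x0 : 'cV[R]_n.+1).
Local Notation x := (cl_traj A B policy w x0).

Lemma nth_cl_states t j : (j <= t)%N ->
  nth x0 (cl_states A B policy w x0 t) j = x (t - j)%N.
Proof.
elim: t j => [|t IH] [|j] //= jt.
by rewrite IH // subSS.
Qed.

Definition block_start t := (t - t %% n.+1)%N.

Definition block_input t : 'cV[R]_m :=
  let y := Y *m x (block_start t) in - (sat y *: (G (n - t %% n.+1) *m y)).

Lemma cl_trajS t : x t.+1 = A *m x t + B *m block_input t + w t.
Proof.
rewrite {1}/cl_traj /=; congr (_ + B *m _ + _).
(* The column that is read has index at most [t], so the history never falls back on its default
   value here. *)
rewrite /policy /block_input; suff -> : col (inord (t %% n.+1))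
  (hist n.+1 x0 (cl_states A B policy w x0 t)) = x (block_start t) by [].
apply/matrixP => i j; rewrite !mxE ord1 inordK ?ltn_mod //.
by rewrite nth_cl_states // leq_mod.
Qed.

Lemma enorm_block_input t :
  enorm (block_input t) <= \sum_(i < n.+1) frob (G i).
Proof.
rewrite /block_input -scaleN1r enormZ normrN1 mul1r; apply: enorm_input.
by rewrite ltnS leq_subr.
Qed.

Definition block_noise q : 'cV[R]_N :=
  \sum_(i < n.+1) Y *m A ^+ (n - i) *m w (q * n.+1 + i)%N.

Definition drifted q : 'cV[R]_N :=
  let z := x (q * n.+1)%N in (1 - sat (Y *m z)) *: (Y *m A ^+ n.+1 *m z).

(** Variation of constants over one block: by [YG] the unscaled inputs would cancel Y A^(n+1) z, so
    the scaled ones leave the fraction 1 - [sat] of it. *)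
Lemma block_step q :
  Y *m x (q.+1 * n.+1)%N = drifted q + block_noise q.
Proof.
set z := x (q * n.+1)%N.
pose v i := - (sat (Y *m z) *: (B *m (G (n - i) *m (Y *m z))))
  + w (q * n.+1 + i)%N.
have H j : (j < n.+1)%N ->
    x (q * n.+1 + j.+1)%N = A *m x (q * n.+1 + j)%N + v j.
  move=> jn; rewrite addnS cl_trajS -addrA; congr (_ + (_ + _)).
  rewrite /block_input /block_start modnMDl modn_small // addnK -/z.
  by rewrite mulmxN -scalemxAr.
have := @affine_iter _ _ A (fun j => x (q * n.+1 + j)%N) v n.+1 H n.+1 (leqnn _).
rewrite addn0 -/z mulSn addnC => ->.
rewrite mulmxDr mulmxA mulmx_sumr.
have -> : \sum_(i < n.+1) Y *m (A ^+ (n.+1 - i.+1) *m v i)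
   = - (sat (Y *m z) *: (Y *m A ^+ n.+1 *m z)) + block_noise q.
  have -> : \sum_(i < n.+1) Y *m (A ^+ (n.+1 - i.+1) *m v i)
     = \sum_(i < n.+1) - (sat (Y *m z) *:
         (Y *m (A ^+ (n - i) *m B *m G (n - i)%N) *m Y *m z)) + block_noise q.
    rewrite /block_noise -big_split; apply: eq_bigr => i _ /=.
    by rewrite subSS /v !mulmxDr !mulmxN -!scalemxAr !mulmxA.
  congr (_ + _); rewrite sumrN -scaler_sumr; congr (- (_ *: _)).
  (* The input at step i of a block is propagated by A^(n-i) and therefore uses the gain of index n
     - i; reversing the sum matches [YG]. *)
  rewrite -YG !(mulmx_sumr, mulmx_suml) [RHS](reindex_inj rev_ord_inj).
  by apply: eq_bigr => i _; rewrite /= subSS.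
by rewrite addrA /drifted -/z scalerBl scale1r.
Qed.

(** [A] preserves |Y z|, and b (1 - 1 / max(1, b)) is the positive part of b - 1. *)
Lemma enorm_drifted q :
  enorm (drifted q) = Num.max 0 (enorm (Y *m x (q * n.+1)%N) - 1).
Proof.
rewrite /drifted enormZ enorm_YA ger0_norm ?subr_ge0 ?sat_le1 //.
set b := enorm _; rewrite /sat -/b; have [b1|b1] := leP b 1.
  by rewrite invr1 subrr mul0r; symmetry; apply/max_idPl; lra.
rewrite mulrBl mul1r mulVf; last by rewrite gt_eqF; lra.
by symmetry; apply/max_idPr; lra.
Qed.

Lemma stable_recursion t :
  x t.+1 = (A - L *m Y) *m x t
           + (L *m (Y *m x t) + B *m block_input t + w t).
Proof.
by rewrite cl_trajS mulmxBl -mulmxA -!addrA; congr (_ + _); rewrite !addrA addNr add0r.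
Qed.

End Trajectory.

(** Near the origin the first block is unsaturated and brings Y x to 0. From then on the input
    vanishes, and on the kernel of [Y] the matrices A and A - L Y coincide, so the state decays. *)
Lemma policy_asymp_stable : asymp_stable (cl_traj A B policy (fun=> 0)).
Proof.
pose x x0 := cl_traj A B policy (fun=> 0) x0.
have r0 : 0 <= rho by case/andP: rho01 => /ltW.
pose g := \sum_(i < n.+1) frob (B *m G i *m Y).
have g0 : 0 <= g by apply: sumr_ge0 => i _; exact: frob_ge0.
(* Growth factor per step in the first block, where inputs are bounded by a multiple of |x0|; the 1
   makes its powers nondecreasing. *)
pose M := frob A + g + 1.
have M1 : 1 <= M by rewrite /M lerDr addr_ge0 ?frob_ge0.
pose C := n.+1%:R * c * M ^+ n.+1 + M ^+ n.+1.
have c0 : 0 <= c.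
  by have := Fdecay 0%N 0 0; rewrite expr0 mulr1; apply: le_trans.
have nc0 : 0 <= n.+1%:R * c by rewrite mulr_ge0.
have C1 : 0 < C.
  apply: (@lt_le_trans _ _ (M ^+ n.+1)); first by rewrite exprn_gt0; lra.
  by rewrite lerDr mulr_ge0 // exprn_ge0; lra.
have early x0 j : (j <= n.+1)%N -> enorm (x x0 j) <= M ^+ j * enorm x0.
  elim: j => [|j IH] jn; first by rewrite expr0 mul1r.
  rewrite /x cl_trajS addr0 -/(x x0); apply: le_trans (enormD _ _) _.
  rewrite /block_input /block_start modn_small // subnn mulmxN -/(x x0).
  rewrite -scaleN1r enormZ normrN1 mul1r -scalemxAr enormZ ger0_norm ?sat_ge0 //.
  have h1 : enorm (A *m x x0 j) <= frob A * (M ^+ j * enorm x0).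
    apply: le_trans (enorm_mulmx _ _) _.
    by rewrite ler_wpM2l ?frob_ge0 // IH // ltnW.
  have h2 : sat (Y *m x x0 0%N) * enorm (B *m (G (n - j) *m (Y *m x x0 0%N)))
      <= g * (M ^+ j * enorm x0).
    apply: (@le_trans _ _ (1 * enorm (B *m (G (n - j) *m (Y *m x x0 0%N))))).
      by rewrite ler_wpM2r ?enorm_ge0 // sat_le1.
    rewrite mul1r !mulmxA; apply: le_trans (enorm_mulmx _ _) _.
    apply: ler_pM; rewrite ?frob_ge0 ?enorm_ge0 //.
      have jn' : (n - j < n.+1)%N by rewrite ltnS leq_subr.
      by rewrite /g (bigD1 (Ordinal jn')) //= lerDl sumr_ge0 // => i _; exact: frob_ge0.
    by rewrite -[X in X <= _]mul1r ler_wpM2r ?enorm_ge0 // exprn_ege1.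
  have h3 : 0 <= M ^+ j * enorm x0.
    by rewrite mulr_ge0 ?enorm_ge0 // exprn_ge0; lra.
  by rewrite exprS /M; lra.
(* This radius ensures |Y x0| <= 1, so that nothing is scaled down in the first block. *)
pose d0 := (frob Y + 1)^-1.
have Y1 : 0 < frob Y + 1 by rewrite ltr_wpDl ?frob_ge0.
have d00 : 0 < d0 by rewrite invr_gt0.
have noise0 q : block_noise (fun=> 0) q = 0 :> 'cV[R]_N.
  by rewrite /block_noise big1 // => i _; rewrite mulmx0.
have blocks x0 q : enorm x0 < d0 -> Y *m x x0 (q.+1 * n.+1)%N = 0.
  move=> x0d; apply: enorm_eq0; elim: q => [|q IH].
    rewrite /x block_step noise0 // addr0 enorm_drifted; apply/max_idPl.
    rewrite mul0n subr_le0; apply: le_trans (enorm_mulmx _ _) _.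
    apply: (@le_trans _ _ ((frob Y + 1) * d0)); last by rewrite divff ?gt_eqF.
    by apply: ler_pM; rewrite ?frob_ge0 ?enorm_ge0 ?lerDl // ltW.
  rewrite /x block_step noise0 // addr0 enorm_drifted IH.
  by apply/max_idPl; lra.
have free x0 s : enorm x0 < d0 ->
    x x0 (n.+1 + s.+1)%N = A *m x x0 (n.+1 + s)%N.
  move=> x0d; rewrite addnS {1}/x cl_trajS addr0 -/(x x0).
  rewrite /block_input; set y := Y *m _.
  have -> : y = 0.
    rewrite /y /block_start -/(x x0).
    rewrite [X in (X - _)%N](divn_eq (n.+1 + s) n.+1) addnK divnDl // divnn.
    by rewrite ltn0Sn add1n blocks.
  by rewrite !mulmx0 scaler0 oppr0 mulmx0 addr0.
have late x0 s : enorm x0 < d0 ->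
    enorm (x x0 (n.+1 + s)%N) <= C * rho ^+ s * enorm x0.
  move=> x0d.
  have Y0 k : Y *m x x0 (n.+1 + k)%N = 0.
    apply: enorm_eq0; elim: k => [|k IH].
      by rewrite addn0 -[X in x x0 X]mul1n blocks // enorm0.
    by rewrite free // mulmxA -[Y *m A]/(Y *m A ^+ 1) enorm_YA.
  have xE k : x x0 (n.+1 + k)%N = (A - L *m Y) ^+ k *m x x0 n.+1.
    elim: k => [|k IH]; first by rewrite addn0 expr0 mul1mx.
    rewrite exprS -mulmxE -mulmxA -IH mulmxBl -mulmxA Y0 mulmx0 subr0.
    by rewrite free.
  rewrite xE; apply: le_trans (enorm_mulmx _ _) _.
  apply: (@le_trans _ _ (n.+1%:R * c * rho ^+ s * (M ^+ n.+1 * enorm x0))).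
    apply: ler_pM; rewrite ?frob_ge0 ?enorm_ge0 ?early //.
    exact: frob_geometric.
  rewrite [X in X <= _](_ : _ = n.+1%:R * c * M ^+ n.+1 * rho ^+ s * enorm x0); last by ring.
  rewrite ler_wpM2r ?enorm_ge0 // ler_wpM2r ?exprn_ge0 //.
  by rewrite /C lerDl exprn_ge0; lra.
have bound x0 t : enorm x0 < d0 -> enorm (x x0 t) <= C * enorm x0.
  move=> x0d; have [tn|nt] := leqP t n.+1.
    apply: le_trans (early _ _ tn) _; rewrite ler_wpM2r ?enorm_ge0 //.
    apply: (@le_trans _ _ (M ^+ n.+1)); first by rewrite ler_weXn2l.
    by rewrite /C lerDr mulr_ge0 // exprn_ge0; lra.
  rewrite -(subnKC (ltnW nt)); apply: le_trans (late _ _ x0d) _.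
  rewrite ler_wpM2r ?enorm_ge0 // ler_piMr ?(ltW C1) //.
  by rewrite exprn_ile1 //; case/andP: rho01 => _ /ltW.
split.
  move=> e e0; exists (Num.min d0 (e / C)).
    by rewrite lt_min d00 divr_gt0.
  move=> x0; rewrite lt_min => /andP[x0d x0e] t.
  apply: le_lt_trans (bound _ _ x0d) _.
  by rewrite mulrC -ltr_pdivlMr.
exists d0 => // x0 x0d e e0.
have r1 : `|rho| < 1 by rewrite ger0_norm //; case/andP: rho01.
(* The 1 in the denominator keeps it positive for x0 = 0. *)
have := cvg_expr r1; move=> /cvgrPdist_lt /(_ (e / (C * enorm x0 + 1))).
have K0 : 0 < C * enorm x0 + 1.
  by rewrite ltr_wpDl // mulr_ge0 ?enorm_ge0 // ltW.
move=> /(_ (divr_gt0 e0 K0)) [N0 _ HN].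
exists (n.+1 + N0)%N => t tN.
have tn : (n.+1 <= t)%N by apply: leq_trans tN; rewrite leq_addr.
rewrite -(subnKC tn); apply: le_lt_trans (late _ _ x0d) _.
have /= := HN (t - n.+1)%N; rewrite /= leq_subRL // => /(_ tN).
rewrite sub0r normrN ger0_norm ?exprn_ge0 // ltr_pdivlMr //.
apply: le_lt_trans; rewrite mulrAC mulrC ler_wpM2l ?exprn_ge0 //.
by rewrite lerDl.
Qed.

End ClosedLoop.

(** * Expectation and independence *)

Section Expectation.
Context {dO : measure_display} {Omega : measurableType dO} {R : realType}
  (P : probability Omega R).

Definition itg (f : Omega -> R) : Prop := P.-integrable setT (EFin \o f).
Definition Ex (f : Omega -> R) : R := Rintegral P setT f.

Lemma itgP (f : Omega -> R) : itg f <->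
  measurable_fun setT f /\ (\int[P]_x `|(f x)%:E| < +oo)%E.
Proof.
split=> [/integrableP [/measurable_EFinP]//|[mf foo]].
by apply/integrableP; split=> //; exact/measurable_EFinP.
Qed.

Lemma itg_cst (c : R) : itg (fun=> c).
Proof. exact: finite_measure_integrable_cst. Qed.

Lemma itgD f g : itg f -> itg g -> itg (fun x => f x + g x).
Proof.
by move=> hf hg; apply: (@integrableD _ _ _ _ _ _ (EFin \o f) (EFin \o g)).
Qed.

Lemma itgB f g : itg f -> itg g -> itg (fun x => f x - g x).
Proof.
by move=> hf hg; apply: (@integrableB _ _ _ _ _ _ (EFin \o f) (EFin \o g)).
Qed.

Lemma itgZ (c : R) f : itg f -> itg (fun x => c * f x).
Proof.
by move=> hf; apply: (@integrableZl _ _ _ _ _ _ c (EFin \o f)).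
Qed.

Lemma itg_sum (I : Type) (s : seq I) (h : I -> Omega -> R) :
  (forall i, itg (h i)) -> itg (fun x => \sum_(i <- s) h i x).
Proof.
move=> H; elim: s => [|i s IH].
  rewrite (_ : (fun _ => _) = fun=> 0); last by apply/funext => x; rewrite big_nil.
  exact: itg_cst.
rewrite (_ : (fun _ => _) = fun x => h i x + \sum_(j <- s) h j x).
  exact: itgD.
by apply/funext => x; rewrite big_cons.
Qed.

Lemma itg_le (f g : Omega -> R) : measurable_fun setT f -> itg g ->
  (forall x, `|f x| <= g x) -> itg f.
Proof.
move=> mf hg fg; apply: le_integrable hg => //; first exact/measurable_EFinP.
by move=> x _ /=; rewrite lee_fin (le_trans (fg x)) // ler_norm.
Qed.

Lemma Ex_fin f : itg f -> (\int[P]_x (f x)%:E)%E = (Ex f)%:E.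
Proof.
by move=> hf; rewrite /Ex /Rintegral fineK //; exact: integrable_fin_num.
Qed.

Lemma Ex_cst (c : R) : Ex (fun=> c) = c.
Proof. by rewrite /Ex Rintegral_cst //= probability_setT mulr1. Qed.

Lemma ExD f g : itg f -> itg g -> Ex (fun x => f x + g x) = Ex f + Ex g.
Proof. by move=> hf hg; exact: RintegralD. Qed.

Lemma ExZ (c : R) f : itg f -> Ex (fun x => c * f x) = c * Ex f.
Proof. by move=> hf; exact: RintegralZl. Qed.

Lemma Ex_sum (I : Type) (s : seq I) (h : I -> Omega -> R) :
  (forall i, itg (h i)) ->
  Ex (fun x => \sum_(i <- s) h i x) = \sum_(i <- s) Ex (h i).
Proof.
move=> H; elim: s => [|i s IH].
  rewrite big_nil -[RHS]Ex_cst; congr Ex; apply/funext => x.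
  by rewrite big_nil.
rewrite big_cons -IH -ExD //; last exact: itg_sum.
by congr Ex; apply/funext => x; rewrite big_cons.
Qed.

Lemma Ex_le f g : itg f -> itg g -> (forall x, f x <= g x) -> Ex f <= Ex g.
Proof. by move=> hf hg fg; exact: le_Rintegral. Qed.

Lemma itg_ge0_lty (f : Omega -> R) (M : R) : measurable_fun setT f -> (forall x, 0 <= f x) ->
  (\int[P]_x (f x)%:E <= M%:E)%E -> itg f /\ Ex f <= M.
Proof.
move=> mf f0 fM; have hf : itg f.
  apply/itgP; split=> //; apply: le_lt_trans (ltry M).
  apply: le_trans fM; rewrite le_eqVlt; apply/orP; left; apply/eqP.
  by apply: eq_integral => x _; rewrite gee0_abs // lee_fin.
by split=> //; rewrite -lee_fin -Ex_fin.
Qed.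

End Expectation.

(** * Expectation of a product of independent variables *)

Section IndependentExpectation.
Context {dO d1 d2 : measure_display} {Omega : measurableType dO}
  {O1 : measurableType d1} {O2 : measurableType d2} {R : realType}
  (P : probability Omega R).
Context (X : {mfun Omega >-> O1}) (Z : {mfun Omega >-> O2}).
Hypothesis XZ : forall S T, measurable S -> measurable T ->
  P (X @^-1` S `&` Z @^-1` T) = (P (X @^-1` S) * P (Z @^-1` T))%E.

(** The joint law agrees with the product of the two laws on rectangles, hence everywhere; Fubini
    then gives integrability of the product and factors its integral. *)
Lemma indep_expectation (f : O1 -> R) (g : O2 -> R) :
  measurable_fun setT f -> measurable_fun setT g ->
  itg P (f \o X) -> itg P (g \o Z) ->
  itg P (fun om => f (X om) * g (Z om)) /\
  Ex P (fun om => f (X om) * g (Z om)) = Ex P (f \o X) * Ex P (g \o Z).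
Proof.
move=> mf mg hf hg.
pose m1 : probability O1 R := distribution P X.
pose m2 : probability O2 R := distribution P Z.
have mT : measurable_fun setT (fun om => (X om, Z om)).
  by apply: measurable_fun_pair.
pose T : {mfun Omega >-> (O1 * O2)%type} := mfun_Sub (mem_set mT).
pose m12 : probability (O1 * O2)%type R := distribution P T.
have prodE S : measurable S -> (m1 \x m2)%E S = m12 S.
  apply: product_measure_unique => U V mU mV.
  exact: XZ.
pose h (z : O1 * O2) : R := f z.1 * g z.2.
have mh : measurable_fun setT h.
  by apply: measurable_funM; exact: measurableT_comp.
have intE (k : O1 * O2 -> \bar R) :
    (\int[m1 \x m2]_z k z = \int[m12]_z k z)%E.
  by apply: eq_measure_integral => S mS _; exact: prodE.
have hf1 : m1.-integrable setT (EFin \o f).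
  apply/integrableP; split; first exact/measurable_EFinP.
  rewrite ge0_integral_distribution //; first by have /integrableP[] := hf.
  exact/measurableT_comp/measurable_EFinP.
have hg2 : m2.-integrable setT (EFin \o g).
  apply/integrableP; split; first exact/measurable_EFinP.
  rewrite ge0_integral_distribution //; first by have /integrableP[] := hg.
  exact/measurableT_comp/measurable_EFinP.
have hh : (m1 \x m2)%E.-integrable setT (EFin \o h).
  apply/integrable12ltyP; first exact/measurable_EFinP.
  have inner x : (\int[m2]_y `|(EFin \o h) (x, y)|
      = `|f x|%:E * \int[m2]_y `|(EFin \o g) y|)%E.
    rewrite -ge0_integralZl //; last exact/measurableT_comp/measurable_EFinP.
    by apply: eq_integral => y _; rewrite /h /= normrM EFinM.
  under eq_integral => x _ do rewrite inner.
  have /integrableP[_ gfin] := hg2; have /integrableP[_ ffin] := hf1.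
  rewrite ge0_integralZr //; last 2 first.
    by apply/measurable_EFinP; exact: measurableT_comp.
    exact: integral_ge0.
  by rewrite lte_mul_pinfty // ?ge0_fin_numE //; apply: integral_ge0.
have hT : itg P (h \o T).
  apply/itgP; split; first exact: measurableT_comp.
  have /integrableP[_] := hh; rewrite intE ge0_integral_distribution //.
  exact/measurableT_comp/measurable_EFinP.
split=> //; apply: EFin_inj; rewrite -Ex_fin // EFinM -!Ex_fin //.
transitivity (\int[m12]_z (h z)%:E)%E.
  rewrite integral_distribution //; exact/measurable_EFinP.
rewrite -intE -integral12_prod_meas1 // /fubini_F.
have inner x : (\int[m2]_y (EFin \o h) (x, y)
    = (f x)%:E * \int[m2]_y (EFin \o g) y)%E.
  by rewrite -integralZl.
under eq_integral => x _ do rewrite inner.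
have -> : (\int[m2]_y (g y)%:E = \int[P]_x ((g \o Z) x)%:E)%E.
  by rewrite integral_distribution //; exact/measurable_EFinP.
have -> : (\int[P]_x ((f \o X) x)%:E = \int[m1]_x (f x)%:E)%E.
  by rewrite integral_distribution //; exact/measurable_EFinP.
by rewrite Ex_fin // integralZr.
Qed.

End IndependentExpectation.

(** * Independence of the present noise from the past *)

Section PastIndependence.
Context {dO : measure_display} {Omega : measurableType dO} {R : realType}
  (P : probability Omega R) {n : nat} (w : nat -> Omega -> 'cV[R]_n).
Hypothesis mw : forall t i, measurable_fun setT (fun om => w t om i 0).
Hypothesis indw : mutually_independent P w.

Definition coord_gen (s : nat) : set (set Omega) :=
  [set E | exists (i : 'I_n) (Bs : set R), measurable Bs /\
     E = (fun om => w s om i 0) @^-1` Bs].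

(** A pi-system, with one event for each earlier noise vector, that generates the sigma-algebra of
    the past. *)
Definition past_gen (t : nat) : set (set Omega) :=
  [set E | exists F : nat -> set Omega,
     (forall s, (s < t)%N -> rv_sigma (w s) (F s)) /\
     E = [set om | forall s, (s < t)%N -> F s om]].

Lemma rv_sigma_measurable s : rv_sigma (w s) `<=` measurable.
Proof.
apply: smallest_sub; first exact: sigma_algebra_measurable.
by move=> _ [i [Bs [mB ->]]]; rewrite -[_ @^-1` _]setTI; exact: mw.
Qed.

Lemma past_genE t (F : nat -> set Omega) :
  [set om | forall s, (s < t)%N -> F s om] =
  [set om | forall s, s \in iota 0 t -> F s om].
Proof.
by apply/seteqP; split=> om /= H s; have := H s; rewrite mem_iota.
Qed.

Lemma past_gen_prob t (F : nat -> set Omega) :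
  (forall s, (s < t)%N -> rv_sigma (w s) (F s)) ->
  P [set om | forall s, (s < t)%N -> F s om]
  = (\prod_(s <- iota 0 t) P (F s))%E.
Proof.
move=> HF; rewrite past_genE indw ?iota_uniq // => s.
by rewrite mem_iota => /andP[_]; exact: HF.
Qed.

Lemma past_gen_measurable t : past_gen t `<=` measurable.
Proof.
move=> _ [F [HF ->]].
have -> : [set om | forall s, (s < t)%N -> F s om] = \bigcap_(s in `I_t) F s.
  by [].
apply: fin_bigcap_measurable; first exact: finite_II.
by move=> s st; apply: (rv_sigma_measurable s); exact: HF.
Qed.

Lemma past_gen_setI t : setI_closed (past_gen t).
Proof.
move=> _ _ [F [HF ->]] [F' [HF' ->]]; exists (fun s => F s `&` F' s); split.
  move=> s st.
  exact: (@measurableI _ (g_sigma_algebraType (coord_gen s)) _ _ (HF s st) (HF' s st)).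
apply/seteqP; split=> om /=; first by move=> [H H'] s st; split; [exact: H|exact: H'].
by move=> H; split=> s st; have [] := H s st.
Qed.

(** As functions of [E], both sides are finite measures that agree on the pi-system [past_gen]. *)
Lemma past_independent t s E S : (t <= s)%N -> <<s past_gen t >> E ->
  rv_sigma (w s) S -> P (E `&` S) = (P E * P S)%E.
Proof.
move=> ts HE HS; have mS := rv_sigma_measurable _ _ HS.
pose r : {nonneg R} := NngNum (fine_ge0 (measure_ge0 P S)).
have rE : (r%:num)%:E = P S by rewrite /= fineK // fin_num_measure.
have mscE X : mscale r P X = (P S * P X)%E by rewrite -rE.
rewrite muleC -mscE.
rewrite -[LHS]/(mrestr P mS E).
have GT : past_gen t setT.
  exists (fun=> setT); split; last by apply/seteqP; split.
  by move=> s' _; exact: (@measurableT _ (g_sigma_algebraType (coord_gen s'))).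
apply: (@g_sigma_algebra_measure_unique _ _ _ (past_gen t) (@past_gen_measurable t)
  (fun=> setT)) => //.
- by apply/seteqP; split=> // om _; exists 0%N.
- exact: past_gen_setI.
- move=> _ [F [HF ->]]; 
  transitivity (P S * P [set om | forall s, (s < t)%N -> F s om])%E; last first.
    exact/esym/mscE.
  transitivity (P ([set om | forall s, (s < t)%N -> F s om] `&` S)) => //.
  rewrite past_gen_prob //.
  (* The event [S] is placed at index [s], which lies outside [iota 0 t], and mutual independence is
     applied to the enlarged family. *)
  pose F' s' := if s' == s then S else F s'.
  have -> : [set om | forall s', (s' < t)%N -> F s' om] `&` S
      = [set om | forall s', s' \in s :: iota 0 t -> F' s' om].
    apply/seteqP; split=> om /=.
      move=> [HF1 HS1] s'; rewrite inE mem_iota /F' => /orP[/eqP ->|/andP[_ st]].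
        by rewrite eqxx.
      by case: eqP => // _; exact: HF1.
    move=> H; split=> [s' st|]; last first.
      by have := H s; rewrite inE eqxx /F' eqxx; apply.
    have := H s'; rewrite inE mem_iota st orbT /F' => /(_ isT).
    by rewrite ifN // neq_ltn (leq_trans st ts).
  have sN : s \notin iota 0 t by rewrite mem_iota /= add0n -leqNgt.
  rewrite indw /=; last 2 first.
  + by rewrite sN iota_uniq.
  + move=> s'; rewrite inE mem_iota /F' => /orP[/eqP ->|/andP[_ st]].
      by rewrite eqxx.
    by case: eqP => [->//|_]; exact: HF.
  rewrite big_cons /F' eqxx; congr (_ * _)%E.
  apply: eq_big_seq => s' s'i; rewrite ifN //.
  by apply: contraNneq sN => <-.
- move=> k; apply: (@le_lt_trans _ _ (P (setT `&` S))) => //.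
  by rewrite setTI; apply: le_lt_trans (probability_le1 _ mS) (ltry _).
Qed.

End PastIndependence.

(** * Measurability of the trajectory *)

Section VectorMeasurability.
Context {d : measure_display} {T : measurableType d} {R : realType}.

(** The source is an arbitrary measurable type, so that the notion serves for the ambient
    sigma-algebra as well as for that of the past. *)
Definition vmeas {n : nat} (f : T -> 'cV[R]_n) : Prop :=
  forall i, measurable_fun setT (fun om => f om i 0).

Lemma measurable_inv_ge0 (f : T -> R) : measurable_fun setT f ->
  (forall x, 0 <= f x) -> measurable_fun setT (fun x => (f x)^-1).
Proof.
move=> mf f0; rewrite (_ : (fun x => _) = (fun y => y `^ (-1)) \o f).
  by apply: measurableT_comp mf; exact: measurable_powR.
by apply/funext => x /=; rewrite powR_inv1.
Qed.

Lemma vmeasD n (f g : T -> 'cV[R]_n) : vmeas f -> vmeas g ->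
  vmeas (fun om => f om + g om).
Proof.
move=> mf mg i; rewrite (_ : (fun om => _) = (fun om => f om i 0 + g om i 0)).
  exact: measurable_funD.
by apply/funext => om; rewrite mxE.
Qed.

Lemma vmeasZ n (a : T -> R) (f : T -> 'cV[R]_n) : measurable_fun setT a ->
  vmeas f -> vmeas (fun om => a om *: f om).
Proof.
move=> ma mf i; rewrite (_ : (fun om => _) = (fun om => a om * f om i 0)).
  exact: measurable_funM.
by apply/funext => om; rewrite mxE.
Qed.

Lemma vmeasN n (f : T -> 'cV[R]_n) : vmeas f -> vmeas (fun om => - f om).
Proof.
move=> mf; rewrite (_ : (fun om => _) = (fun om => -1 *: f om)).
  by apply: vmeasZ => //; exact: measurable_cst.
by apply/funext => om; rewrite scaleN1r.
Qed.

Lemma vmeas_mulmx n k (M : 'M[R]_(k, n)) (f : T -> 'cV[R]_n) :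
  vmeas f -> vmeas (fun om => M *m f om).
Proof.
move=> mf i; rewrite (_ : (fun om => _) = (fun om => \sum_j M i j * f om j 0)).
  by apply: measurable_sum => j; apply: measurable_funM => //; exact: measurable_cst.
by apply/funext => om; rewrite mxE.
Qed.

Lemma measurable_sqn n (f : T -> 'cV[R]_n) : vmeas f ->
  measurable_fun setT (fun om => sqn (f om)).
Proof.
by move=> mf; apply: measurable_sum => i; exact: measurable_funX.
Qed.

Lemma measurable_enorm n (f : T -> 'cV[R]_n) : vmeas f ->
  measurable_fun setT (fun om => enorm (f om)).
Proof.
move=> mf; apply: (@measurableT_comp _ _ _ _ _ _ (@Num.sqrt R)).
  by apply: continuous_measurable_fun; exact: sqrt_continuous.
exact: measurable_sqn.
Qed.

Lemma measurable_sat N (f : T -> 'cV[R]_N) : vmeas f ->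
  measurable_fun setT (fun om => sat (f om)).
Proof.
move=> mf; apply: measurable_inv_ge0 => [|x]; last exact/ltW/max1_gt0.
by apply: measurable_maxr; [exact: measurable_cst|exact: measurable_enorm].
Qed.

Context {n m N : nat} (A : 'M[R]_n.+1) (B : 'M[R]_(n.+1, m))
  (Y : 'M[R]_(N, n.+1)) (G : nat -> 'M[R]_(m, N)).

(** Strong induction, since the input reaches back to the start of the block. Only noise before [t]
    is involved, which lets the result apply to the past sigma-algebra. *)
Lemma vmeas_cl_traj (w : nat -> T -> 'cV[R]_n.+1) x0 t :
  (forall s, (s < t)%N -> vmeas (w s)) ->
  forall s, (s <= t)%N ->
  vmeas (fun om => cl_traj A B (policy Y G) (fun k => w k om) x0 s).
Proof.
move=> mw s; have [k] := ubnP s; elim: k s => // k IH [|s] sk st.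
  by move=> i; exact: measurable_cst.
rewrite (_ : (fun om => _) = (fun om =>
  A *m cl_traj A B (policy Y G) (fun k => w k om) x0 s
  + B *m block_input A B Y G (fun k => w k om) x0 s + w s om)).
  have mx s' : (s' <= s)%N ->
      vmeas (fun om => cl_traj A B (policy Y G) (fun k => w k om) x0 s').
    by move=> s's; apply: IH; [exact: leq_ltn_trans s's sk|exact: leq_trans s's (ltnW st)].
  apply: vmeasD; last exact: mw.
  apply: vmeasD; apply: vmeas_mulmx; first exact: mx.
  apply: vmeasN; apply: vmeasZ.
    by apply: measurable_sat; apply: vmeas_mulmx; apply: mx; exact: leq_subr.
  by do 2 apply: vmeas_mulmx; apply: mx; exact: leq_subr.
by apply/funext => om; rewrite cl_trajS.
Qed.

End VectorMeasurability.

(** * Borel measurability of the policy *)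

Section MatrixBorel.
Import numFieldNormedType.Exports.
Context {R : realType}.

Lemma measurable_entry p q (i : 'I_p) (j : 'I_q) :
  measurable_fun setT
    (fun H : g_sigma_algebraType (@mx_rect R p q) => (H : 'M[R]_(p, q)) i j).
Proof.
move=> _ S mS; rewrite setTI; apply: sub_sigma_algebra.
exists (fun i' j' => if (i' == i) && (j' == j) then S else setT); split.
  by move=> i' j'; case: ifP.
apply/seteqP; split=> H /=.
  by move=> HS i' j'; case: ifP => // /andP[/eqP-> /eqP->].
by move=> /(_ i j); rewrite !eqxx.
Qed.

Lemma mx_measurable_entries p q r s (f : 'M[R]_(p, q) -> 'M[R]_(r, s)) :
  (forall i j, measurable_fun setT
     (fun H : g_sigma_algebraType (@mx_rect R p q) => f H i j)) ->
  mx_measurable_fun f.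
Proof.
move=> mf S HS.
pose g : g_sigma_algebraType (@mx_rect R p q) ->
  g_sigma_algebraType (@mx_rect R r s) := f.
suff mg : measurable_fun setT g by have := mg measurableT S HS; rewrite setTI.
apply: (@measurability _ _ _ _ setT g (@mx_rect R r s)) => // _ [_ [Bs [mB ->]] <-].
have -> : setT `&` g @^-1` [set M | forall i j, Bs i j (M i j)]
    = \bigcap_(ij in [set: 'I_r * 'I_s]) ((fun H => f H ij.1 ij.2) @^-1` Bs ij.1 ij.2).
  apply/seteqP; split=> H /=; first by move=> [_ HB] [i j] _; exact: HB.
  by move=> HB; split=> // i j; exact: (HB (i, j)).
apply: fin_bigcap_measurable => // -[i j] _ /=.
by rewrite -[_ @^-1` _]setTI; apply: mf.
Qed.

Lemma measurable_policy n m N (Y : 'M[R]_(N, n.+1)) (G : nat -> 'M[R]_(m, N)) t :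
  mx_measurable_fun (policy Y G t).
Proof.
apply: mx_measurable_entries => i j; rewrite (ord1 j).
pose T := g_sigma_algebraType (@mx_rect R n.+1 n.+1).
have mz : @vmeas _ T R _ (fun H => Y *m col (inord (t %% n.+1)) (H : 'M[R]_n.+1)).
  apply: vmeas_mulmx => k.
  rewrite (_ : (fun om => _) = (fun H : T => (H : 'M[R]_n.+1) k (inord (t %% n.+1)))).
    exact: measurable_entry.
  by apply/funext => H; rewrite mxE.
apply: (@vmeasN _ T R _ (fun H => _ *: _)); apply: vmeasZ.
  exact: measurable_sat.
exact: vmeas_mulmx.
Qed.

End MatrixBorel.

(** * Second moments of the closed loop *)

Section PastExpectation.
Context {dO : measure_display} {Omega : measurableType dO} {R : realType}
  (P : probability Omega R) {n : nat} (w : nat -> Omega -> 'cV[R]_n).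
Hypothesis mw : forall t i, measurable_fun setT (fun om => w t om i 0).
Hypothesis indw : mutually_independent P w.

Local Notation past t := (g_sigma_algebraType (past_gen w t)).
Local Notation present s := (g_sigma_algebraType (coord_gen w s)).

Lemma measurable_to_past t : measurable_fun setT (id : Omega -> past t).
Proof.
move=> _ E HE; rewrite setTI preimage_id.
move: E HE; apply: smallest_sub; first exact: sigma_algebra_measurable.
by move=> E GE; apply: (past_gen_measurable w mw t E GE).
Qed.

Lemma measurable_to_present s : measurable_fun setT (id : Omega -> present s).
Proof.
by move=> _ E HE; rewrite setTI preimage_id; exact: (rv_sigma_measurable w mw s).
Qed.

Lemma vmeas_present s : @vmeas _ (present s) R n (w s).
Proof.
move=> i _ S mS; rewrite setTI; apply: sub_sigma_algebra.
by exists i, S.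
Qed.

Lemma vmeas_past s t : (s < t)%N -> @vmeas _ (past t) R n (w s).
Proof.
move=> st i _ S mS; rewrite setTI; apply: sub_sigma_algebra.
exists (fun s' => if s' == s then (fun om => w s om i 0) @^-1` S else setT).
split.
  move=> s' _; case: eqP => [->|_].
    by have := vmeas_present s i measurableT S mS; rewrite setTI.
  exact: (@measurableT _ (present s')).
apply/seteqP; split=> om /=; first by move=> H s' _; case: eqP.
by move=> /(_ s st); rewrite eqxx.
Qed.

Lemma past_measurable t (f : Omega -> R) :
  measurable_fun setT (f : past t -> R) -> measurable_fun setT f.
Proof. by move=> mf; exact: measurableT_comp mf (measurable_to_past t). Qed.

(** The two independent random elements are identity maps, into the coarser sigma-algebras of the
    past and of the noise at time [s]. *)
Lemma past_expectation t s (f g : Omega -> R) : (t <= s)%N ->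
  measurable_fun setT (f : past t -> R) ->
  measurable_fun setT (g : present s -> R) ->
  itg P f -> itg P g ->
  itg P (fun om => f om * g om) /\
  Ex P (fun om => f om * g om) = Ex P f * Ex P g.
Proof.
move=> ts mf mg hf hg.
pose X : {mfun Omega >-> past t} := mfun_Sub (mem_set (measurable_to_past t)).
pose Z : {mfun Omega >-> present s} :=
  mfun_Sub (mem_set (measurable_to_present s)).
apply: (@indep_expectation _ _ _ _ _ _ _ P X Z _ f g mf mg hf hg) => S T mS mT.
exact: (past_independent P w mw indw t s S T ts mS mT).
Qed.

End PastExpectation.

Section Moments.
Context {dO : measure_display} {Omega : measurableType dO} {R : realType}
  (P : probability Omega R) {n m N : nat}.
Context (A : 'M[R]_n.+1) (B : 'M[R]_(n.+1, m)) (Y : 'M[R]_(N, n.+1))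
  (L : 'M[R]_(n.+1, N)) (G : nat -> 'M[R]_(m, N)) (c rho : R).
Hypothesis YA : (Y *m A)^T *m (Y *m A) = Y^T *m Y.
Hypothesis rho01 : 0 < rho < 1.
Hypothesis Fdecay :
  forall t i j, `|((A - L *m Y) ^+ t) i j| <= c * rho ^+ t.
Hypothesis YG :
  Y *m (\sum_(j < n.+1) A ^+ j *m B *m G j) *m Y = Y *m A ^+ n.+1.
Context (w : nat -> Omega -> 'cV[R]_n.+1) (M : R).
Hypothesis mw : forall t i, measurable_fun setT (fun om => w t om i 0).
Hypothesis indw : mutually_independent P w.
Hypothesis w_mean : forall t i, (\int[P]_om (w t om i 0)%:E = 0)%E.
Hypothesis w_moment :
  forall t, (\int[P]_om ((enorm (w t om)) ^+ 4)%:E <= M%:E)%E.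

Lemma w_sqn2 t : itg P (fun om => sqn (w t om) ^+ 2) /\
  Ex P (fun om => sqn (w t om) ^+ 2) <= M.
Proof.
apply: itg_ge0_lty; first exact/measurable_funX/measurable_sqn/mw.
  by move=> om; exact: sqr_ge0.
apply: le_trans (w_moment t); rewrite le_eqVlt; apply/orP; left; apply/eqP.
by apply: eq_integral => om _; rewrite -enorm_sqr -exprM.
Qed.

Lemma M_ge0 : 0 <= M.
Proof.
apply: le_trans (w_sqn2 0).2; apply: Rintegral_ge0 => om _; exact: sqr_ge0.
Qed.

Lemma w_sqn t : itg P (fun om => sqn (w t om)) /\
  Ex P (fun om => sqn (w t om)) <= 1 + M.
Proof.
have [h hM] := w_sqn2 t; have h1 := itgD P _ _ (itg_cst P 1) h.
have hw : itg P (fun om => sqn (w t om)).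
  apply: itg_le h1 _; first exact/measurable_sqn/mw.
  by move=> om; rewrite ger0_norm ?sqn_ge0 //; exact: le_add1_sqr.
split=> //; apply: (@le_trans _ _ (Ex P (fun om => 1 + sqn (w t om) ^+ 2))).
  by apply: Ex_le => // om; exact: le_add1_sqr.
by rewrite ExD ?Ex_cst ?lerD2l //; exact: itg_cst.
Qed.

Lemma w_entry t i : itg P (fun om => w t om i 0) /\
  Ex P (fun om => w t om i 0) = 0.
Proof.
have h : itg P (fun om => w t om i 0).
  apply: itg_le (itgD P _ _ (itg_cst P 1) (w_sqn t).1) _; first exact: mw.
  move=> om; apply: le_trans (norm_le_add1_sqr _) _; rewrite lerD2l.
  exact: entry_sqr_le.
by split=> //; apply: EFin_inj; rewrite -Ex_fin // w_mean.
Qed.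

Section FromInitialState.
Context (x0 : 'cV[R]_n.+1).

Let X t om := cl_traj A B (policy Y G) (fun s => w s om) x0 t.
Let U t om := block_input A B Y G (fun s => w s om) x0 t.
Let Gs : R := \sum_(i < n.+1) frob (G i).

Lemma sqn_U t om : sqn (U t om) <= Gs ^+ 2.
Proof.
rewrite -enorm_sqr lerXn2r ?nnegrE ?enorm_ge0 //.
  by apply: sumr_ge0 => i _; exact: frob_ge0.
exact: enorm_block_input.
Qed.

Lemma X_vmeas t : vmeas (X t).
Proof.
by apply: (vmeas_cl_traj A B Y G w x0 t (fun s _ => mw s) t (leqnn t)).
Qed.

Lemma X_vmeas_past t : @vmeas _ (g_sigma_algebraType (past_gen w t)) R _ (X t).
Proof.
apply: (@vmeas_cl_traj _ (g_sigma_algebraType (past_gen w t)) _ _ _ _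
  A B Y G w x0 t _ t (leqnn t)) => s st.
exact: vmeas_past.
Qed.

(** Finiteness at each time, without uniformity in [t]; it justifies the manipulations of
    expectations below. *)
Lemma X_sqn t : itg P (fun om => sqn (X t om)).
Proof.
elim: t => [|t IH]; first exact: (itg_cst P (sqn x0)).
apply: (itg_le _ _ (fun om => 4 * frob A ^+ 2 * sqn (X t om)
  + (4 * (frob B ^+ 2 * Gs ^+ 2) + 2 * sqn (w t om)))).
- exact/measurable_sqn/X_vmeas.
- by apply: itgD; [exact: itgZ|apply: itgD; [exact: itg_cst|exact/itgZ/(w_sqn t).1]].
move=> om; rewrite ger0_norm ?sqn_ge0 // /X cl_trajS.
apply: le_trans (sqn_affine_le _ _ _ _) _.
rewrite addrA; apply: lerD => //; apply: lerD.
  by rewrite -mulrA ler_wpM2l // sqn_mulmx.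
rewrite ler_wpM2l //; apply: le_trans (sqn_mulmx _ _) _.
by rewrite ler_wpM2l ?sqr_ge0 // sqn_U.
Qed.

Lemma MX_sqn k (K : 'M[R]_(k, n.+1)) t : itg P (fun om => sqn (K *m X t om)).
Proof.
apply: (itg_le _ _ (fun om => frob K ^+ 2 * sqn (X t om))).
- exact/measurable_sqn/vmeas_mulmx/X_vmeas.
- exact/itgZ/X_sqn.
by move=> om; rewrite ger0_norm ?sqn_ge0 // sqn_mulmx.
Qed.

Lemma lyap_itg (k : R) t : itg P (fun om => lyap k (sqn (Y *m X t om))).
Proof.
apply: itg_le (MX_sqn _ Y t) _; last first.
  by move=> om; rewrite ger0_norm ?lyap_ge0 ?lyap_le ?sqn_ge0.
have ms : measurable_fun setT (fun om => sqn (Y *m X t om)).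
  exact/measurable_sqn/vmeas_mulmx/X_vmeas.
apply: measurable_funM; first exact: measurable_funX.
apply: measurable_inv_ge0 => [|om].
  by apply: measurable_funD => //; exact: measurable_cst.
by apply: addr_ge0; [exact: sqn_ge0|exact: sqr_ge0].
Qed.

Let noise_gain : R :=
  n.+1%:R * \sum_(i < n.+1) frob (Y *m A ^+ (n - i)) ^+ 2.

Lemma noise_gain_ge0 : 0 <= noise_gain.
Proof. by rewrite mulr_ge0 // sumr_ge0 // => i _; exact: sqr_ge0. Qed.

Lemma sqn_block_noise q om : sqn (block_noise A Y (fun s => w s om) q)
  <= noise_gain * \sum_(i < n.+1) sqn (w (q * n.+1 + i)%N om).
Proof.
apply: le_trans (sqn_sum_le _) _; rewrite -mulrA ler_wpM2l // mulr_sumr.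
apply: ler_sum => i _; apply: le_trans (sqn_mulmx _ _) _.
rewrite ler_wpM2r ?sqn_ge0 // (bigD1 i) //= lerDl sumr_ge0 // => j _.
exact: sqr_ge0.
Qed.

Lemma sqn_block_noise2 q om : sqn (block_noise A Y (fun s => w s om) q) ^+ 2
  <= noise_gain ^+ 2 * n.+1%:R * \sum_(i < n.+1) sqn (w (q * n.+1 + i)%N om) ^+ 2.
Proof.
have s0 : 0 <= \sum_(i < n.+1) sqn (w (q * n.+1 + i)%N om).
  by apply: sumr_ge0 => i _; exact: sqn_ge0.
apply: (@le_trans _ _ ((noise_gain * \sum_(i < n.+1) sqn (w (q * n.+1 + i)%N om)) ^+ 2)).
  by rewrite lerXn2r ?nnegrE ?sqn_ge0 //; do ?[exact: (mulr_ge0 noise_gain_ge0 s0)|exact: sqn_block_noise].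
by rewrite exprMn -mulrA ler_wpM2l ?sqr_ge0 // sqr_sum_le.
Qed.

(** [c2] is the coefficient of |p|^2 / D left by the quadratic noise term in expectation; [C0] adds
    the remainder c2^3 of [cubic_le] to the fourth-moment term. *)
Let c2 : R := 10 * noise_gain * (n.+1%:R * (1 + M)).
Let C0 : R := c2 ^+ 3 + 2 * noise_gain ^+ 2 * n.+1%:R * (n.+1%:R * M).

Lemma c2_ge0 : 0 <= c2.
Proof.
apply: mulr_ge0; first by apply: mulr_ge0 => //; exact: noise_gain_ge0.
by apply: mulr_ge0 => //; apply: addr_ge0 => //; exact: M_ge0.
Qed.

Lemma C0_ge0 : 0 <= C0.
Proof.
apply: addr_ge0; first exact/exprn_ge0/c2_ge0.
apply: mulr_ge0; last by apply: mulr_ge0 => //; exact: M_ge0.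
by do 2 apply: mulr_ge0 => //; exact: sqr_ge0.
Qed.

Lemma dotv_block_noise q om (p : 'cV[R]_N) :
  dotv p (block_noise A Y (fun s => w s om) q)
  = \sum_(i < n.+1) \sum_(j < n.+1)
      ((Y *m A ^+ (n - i))^T *m p) j 0 * w (q * n.+1 + i)%N om j 0.
Proof.
have dE k (u v : 'cV[R]_k) : dotv u v = (u^T *m v) 0 0.
  by rewrite mxE; apply: eq_bigr => i _; rewrite mxE.
rewrite dE /block_noise mulmx_sumr summxE; apply: eq_bigr => i _.
set K := Y *m _; rewrite mulmxA mxE; apply: eq_bigr => j _; congr (_ * _).
by rewrite -[p^T *m K]trmxK mxE trmx_mul trmxK.
Qed.

(** [lyap_step] is integrated with the block noise split into its vectors. These are independent of
    the state at the block start, so the linear terms have mean zero and the quadratic ones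
    factor. *)
Lemma lyap_expectation_step q (k : R) : 0 < k ->
  Ex P (fun om => lyap k (sqn (Y *m X (q.+1 * n.+1)%N om)))
  <= Ex P (fun om => lyap (k + 1) (sqn (Y *m X (q * n.+1)%N om)))
     + C0 / k ^+ 2.
Proof.
move=> k0; set t0 := (q * n.+1)%N.
have k20 : 0 < k ^+ 2 by rewrite exprn_gt0.
pose past := g_sigma_algebraType (past_gen w t0).
pose y om := Y *m X t0 om.
pose p om := drifted A B Y G (fun s => w s om) x0 q.
pose D om := sqn (p om) + k ^+ 2.
pose phi om := (sqn (p om) ^+ 2 + 2 * sqn (p om) * k ^+ 2) / D om ^+ 2.
have D0 om : 0 < D om by rewrite /D ltr_wpDl ?sqn_ge0.
have sD om : sqn (p om) <= D om by rewrite /D lerDl ltW.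
have kD om : k ^+ 2 <= D om by rewrite /D lerDr sqn_ge0.
have p0 om := sqn_ge0 (p om).
have ym : @vmeas _ past R _ y by apply: vmeas_mulmx; exact: X_vmeas_past.
have pm : @vmeas _ past R _ p.
  apply: (@vmeasZ _ past R _ (fun om => 1 - sat (y om))).
    by apply: measurable_funB; [exact: measurable_cst|exact: measurable_sat].
  by apply: vmeas_mulmx; exact: X_vmeas_past.
have spm : measurable_fun setT ((fun om => sqn (p om)) : past -> R).
  exact: measurable_sqn.
have Dm : measurable_fun setT (D : past -> R).
  by apply: measurable_funD => //; exact: measurable_cst.
have phim : measurable_fun setT (phi : past -> R).
  apply: measurable_funM.
    apply: measurable_funD; first exact: measurable_funX.
    by apply: measurable_funM; [apply: measurable_funM => //|]; exact: measurable_cst.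
  apply: measurable_inv_ge0; first exact: measurable_funX.
  by move=> om; exact: sqr_ge0.
have phi01 om : 0 <= phi om <= 1.
  apply/andP; split.
    apply: divr_ge0; last exact: sqr_ge0.
    apply: addr_ge0; first exact: sqr_ge0.
    by apply: mulr_ge0; [exact: mulr_ge0|exact: sqr_ge0].
  rewrite ler_pdivrMr ?exprn_gt0 // mul1r /D.
  by have := sqr_ge0 (k ^+ 2); lra.
have yi : itg P (fun om => sqn (y om)) by exact: MX_sqn.
have py om : sqn (p om) <= sqn (y om).
  rewrite -!enorm_sqr lerXn2r ?nnegrE ?enorm_ge0 // /p enorm_drifted //.
  by rewrite ge_max enorm_ge0 /= gerBl.
have pi : itg P (fun om => sqn (p om)).
  apply: itg_le yi _; first exact: past_measurable spm.
  by move=> om; rewrite ger0_norm.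
pose T1 om := lyap (k + 1) (sqn (y om)) - enorm (p om) ^+ 3 / D om.
have cubi : itg P (fun om => enorm (p om) ^+ 3 / D om).
  apply: itg_le (itgD P _ _ (itg_cst P 1) pi) _.
    apply: (past_measurable w mw t0); apply: measurable_funM.
      by apply: measurable_funX; exact: measurable_enorm.
    by apply: measurable_inv_ge0 => // om; exact: ltW.
  move=> om; rewrite ger0_norm; last by apply: divr_ge0; [exact/exprn_ge0/enorm_ge0|exact/ltW].
  rewrite ler_pdivrMr //; have e0 := enorm_ge0 (p om); have := sD om.
  rewrite exprS enorm_sqr => /(ler_wpM2l e0) /le_trans; apply.
  rewrite ler_wpM2r ?(ltW (D0 om)) //; apply: le_trans (le_add1_sqr _) _.
  by rewrite enorm_sqr.
have T1i : itg P T1 by apply: itgB => //; exact: lyap_itg.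
pose f (i j : 'I_n.+1) om := 2 * phi om * ((Y *m A ^+ (n - i))^T *m p om) j 0.
pose g om := 10 * noise_gain * (sqn (p om) / D om).
have fm i j : measurable_fun setT (f i j : past -> R).
  apply: measurable_funM.
    by apply: measurable_funM => //; exact: measurable_cst.
  exact: (@vmeas_mulmx _ past R _ _ _ p pm j).
have fi i j : itg P (f i j).
  apply: (itg_le _ _ (fun om => 2 * (1 + frob (Y *m A ^+ (n - i))^T ^+ 2 * sqn (p om)))).
  - exact: past_measurable (fm i j).
  - by apply: itgZ; apply: itgD; [exact: itg_cst|exact: itgZ].
  move=> om; have /andP[ph0 ph1] := phi01 om.
  rewrite /f normrM (ger0_norm (mulr_ge0 (ler0n R 2) ph0)).
  apply: (@le_trans _ _ (2 * `|((Y *m A ^+ (n - i))^T *m p om) j 0|)).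
    by rewrite ler_wpM2r // -[X in _ <= X]mulr1 ler_wpM2l.
  rewrite ler_wpM2l //; apply: le_trans (norm_le_add1_sqr _) _; rewrite lerD2l.
  by apply: le_trans (entry_sqr_le _ _ _) _; exact: sqn_mulmx.
have gm : measurable_fun setT (g : past -> R).
  apply: measurable_funM; first exact: measurable_cst.
  apply: measurable_funM; first exact: spm.
  by apply: measurable_inv_ge0 => [|x]; [exact: Dm|exact: ltW].
have g01 om : 0 <= sqn (p om) / D om <= 1.
  by rewrite divr_ge0 ?(ltW (D0 om)) //= ler_pdivrMr // mul1r.
have gi : itg P g.
  apply: itg_le (itg_cst P (10 * noise_gain)) _; first exact: past_measurable gm.
  move=> om; have /andP[h0 h1] := g01 om; have h := noise_gain_ge0.
  have h10 : 0 <= 10 * noise_gain by exact: mulr_ge0.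
  by rewrite ger0_norm /g ?(mulr_ge0 h10) // -[X in _ <= X]mulr1 ler_wpM2l.
pose W2 om := \sum_(i < n.+1) sqn (w (t0 + i)%N om) ^+ 2.
have W2i : itg P W2 by apply: itg_sum => i; exact: (w_sqn2 _).1.
have fw i j : itg P (fun om => f i j om * w (t0 + i)%N om j 0) /\
    Ex P (fun om => f i j om * w (t0 + i)%N om j 0) = 0.
  have [h1 h2] := w_entry (t0 + i)%N j.
  have [h3 h4] := past_expectation P w mw indw t0 (t0 + i)%N _ _ (leq_addr _ _)
    (fm i j) (vmeas_present w (t0 + i)%N j) (fi i j) h1.
  by split=> //; rewrite h4 h2 mulr0.
have gw (i : 'I_n.+1) : itg P (fun om => g om * sqn (w (t0 + i)%N om)) /\
    Ex P (fun om => g om * sqn (w (t0 + i)%N om)) <= (1 + M) * Ex P g.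
  have [h1 h2] := w_sqn (t0 + i)%N.
  have [h3 h4] := past_expectation P w mw indw t0 (t0 + i)%N _ _ (leq_addr _ _)
    gm (measurable_sqn _ _ (vmeas_present w (t0 + i)%N)) gi h1.
  split=> //; rewrite h4 mulrC ler_wpM2r //.
  apply: Rintegral_ge0 => om _; have /andP[a0 _] := g01 om.
  by apply: mulr_ge0 => //; apply: mulr_ge0 => //; exact: noise_gain_ge0.
(* The summands are, in order, the part known at the block start and the parts linear, quadratic and
   quartic in the noise. *)
pose V om := T1 om + (\sum_(i < n.+1) \sum_(j < n.+1) f i j om * w (t0 + i)%N om j 0
  + (\sum_(i < n.+1) g om * sqn (w (t0 + i)%N om)
     + 2 / k ^+ 2 * (noise_gain ^+ 2 * n.+1%:R) * W2 om)).
have pathwise om : lyap k (sqn (Y *m X (q.+1 * n.+1)%N om)) <= V om.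
  have b0 := enorm_ge0 (y om).
  have pE : enorm (p om) = Num.max 0 (enorm (y om) - 1) by exact: enorm_drifted.
  set v := block_noise A Y (fun s => w s om) q.
  have h1 : phi om * (2 * dotv (p om) v)
      = \sum_(i < n.+1) \sum_(j < n.+1) f i j om * w (t0 + i)%N om j 0.
    rewrite /v dotv_block_noise mulrA mulr_sumr; apply: eq_bigr => i _.
    by rewrite mulr_sumr; apply: eq_bigr => j _; rewrite /f; ring.
  have h2 : 10 * (sqn (p om) / D om) * sqn v
      <= \sum_(i < n.+1) g om * sqn (w (t0 + i)%N om).
    rewrite -mulr_sumr /g; have /andP[a0 _] := g01 om.
    have := ler_wpM2l (mulr_ge0 (ler0n R 10) a0) (sqn_block_noise q om).
    by move=> /le_trans; apply; apply: eq_ler; ring.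
  have h3 : 2 / k ^+ 2 * sqn v ^+ 2
      <= 2 / k ^+ 2 * (noise_gain ^+ 2 * n.+1%:R) * W2 om.
    rewrite -[X in _ <= X]mulrA; apply: ler_wpM2l; last exact: sqn_block_noise2.
    by apply: divr_ge0 => //; exact: ltW.
  have := lyap_step (p om) v _ _ (D om) k0 b0 pE erefl.
  rewrite /v -block_step // enorm_sqr -/(X _ om) -/(T1 om) -/(phi om) -/v.
  by rewrite h1 => /le_trans; apply; rewrite /V; lra.
have S1i : itg P (fun om => \sum_(i < n.+1) \sum_(j < n.+1) f i j om * w (t0 + i)%N om j 0).
  by apply: itg_sum => i; apply: itg_sum => j; exact: (fw i j).1.
have S2i : itg P (fun om => \sum_(i < n.+1) g om * sqn (w (t0 + i)%N om)).
  by apply: itg_sum => i; exact: (gw i).1.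
have S3i := itgZ P (2 / k ^+ 2 * (noise_gain ^+ 2 * n.+1%:R)) _ W2i.
have S23i := itgD P _ _ S2i S3i; have S123i := itgD P _ _ S1i S23i.
have Vi : itg P V by exact: itgD.
apply: le_trans (Ex_le P _ _ (lyap_itg k _) Vi pathwise) _.
rewrite (ExD P _ _ T1i S123i) (ExD P _ _ S1i S23i) (ExD P _ _ S2i S3i) (ExZ P _ _ W2i).
have -> : Ex P (fun om => \sum_(i < n.+1) \sum_(j < n.+1)
    f i j om * w (t0 + i)%N om j 0) = 0.
  rewrite Ex_sum; last by move=> i; apply: itg_sum => j; exact: (fw i j).1.
  apply: big1 => i _; rewrite Ex_sum; last by move=> j; exact: (fw i j).1.
  by apply: big1 => j _; exact: (fw i j).2.
rewrite add0r.
have S2le : Ex P (fun om => \sum_(i < n.+1) g om * sqn (w (t0 + i)%N om))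
    <= n.+1%:R * (1 + M) * Ex P g.
  rewrite Ex_sum; last by move=> i; exact: (gw i).1.
  apply: (@le_trans _ _ (\sum_(i < n.+1) (1 + M) * Ex P g)).
    by apply: ler_sum => i _; exact: (gw i).2.
  by rewrite sumr_const card_ord -mulrA mulr_natl.
have W2le : Ex P W2 <= n.+1%:R * M.
  rewrite Ex_sum; last by move=> i; exact: (w_sqn2 _).1.
  apply: (@le_trans _ _ (\sum_(i < n.+1) M)).
    by apply: ler_sum => i _; exact: (w_sqn2 _).2.
  by rewrite sumr_const card_ord mulr_natl.
(* The cubic surplus in [T1] absorbs the quadratic noise term up to c2^3 / D, and D is at least
   k^2. *)
have TG : Ex P T1 + n.+1%:R * (1 + M) * Ex P g
    <= Ex P (fun om => lyap (k + 1) (sqn (y om))) + c2 ^+ 3 / k ^+ 2.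
  have gZ := itgZ P (n.+1%:R * (1 + M)) _ gi.
  rewrite -(ExZ P _ _ gi) -(ExD P _ _ T1i gZ) -[X in _ <= _ + X](Ex_cst P).
  rewrite -(ExD P _ _ (lyap_itg (k + 1) t0) (itg_cst P _)).
  apply: Ex_le.
  - by apply: itgD => //; exact: itgZ.
  - by apply: itgD; [exact: lyap_itg|exact: itg_cst].
  move=> om; rewrite /T1 -addrA lerD2l.
  have -> : - (enorm (p om) ^+ 3 / D om) + n.+1%:R * (1 + M) * g om
     = (c2 * enorm (p om) ^+ 2 - enorm (p om) ^+ 3) / D om.
    by rewrite enorm_sqr /g /c2; ring.
  apply: (@le_trans _ _ (c2 ^+ 3 / D om)).
    rewrite ler_wpM2r ?invr_ge0 ?(ltW (D0 om)) //.
    by apply: cubic_le; [exact: c2_ge0|exact: enorm_ge0].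
  by rewrite ler_wpM2l ?exprn_ge0 ?c2_ge0 // lef_pV2 ?posrE.
have k2V : 0 <= 2 / k ^+ 2 * (noise_gain ^+ 2 * n.+1%:R).
  apply: mulr_ge0; first by apply: divr_ge0 => //; exact: ltW.
  by apply: mulr_ge0 => //; exact: sqr_ge0.
have := ler_wpM2l k2V W2le.
have -> : 2 / k ^+ 2 * (noise_gain ^+ 2 * n.+1%:R) * (n.+1%:R * M)
  = 2 * noise_gain ^+ 2 * n.+1%:R * (n.+1%:R * M) / k ^+ 2 by ring.
rewrite /C0 mulrDl; lra.
Qed.

(** Each block further back raises [k] by one, so the errors C0 / (k + j)^2 are summable. *)
Lemma lyap_expectation q (k : R) : 1 <= k ->
  Ex P (fun om => lyap k (sqn (Y *m X (q * n.+1)%N om)))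
  <= sqn (Y *m x0) + 2 * C0 / k.
Proof.
have h0 := C0_ge0; elim: q k => [|q IH] k k1.
  apply: (@le_trans _ _ (sqn (Y *m x0))); last first.
    by rewrite lerDl divr_ge0 ?mulr_ge0 //; lra.
  rewrite -[X in _ <= X](Ex_cst P).
  apply: Ex_le; [exact: lyap_itg|exact: itg_cst|move=> om].
  by apply: lyap_le; exact: sqn_ge0.
have k0 : 0 < k by lra.
apply: le_trans (lyap_expectation_step q k k0) _.
have := IH (k + 1) (ler_wpDr ler01 k1).
(* Telescoping: 2 / k - 2 / (k + 1) = 2 / (k (k + 1)), which is at least 1 / k^2 for k >= 1. *)
suff : 2 * C0 / (k + 1) + C0 / k ^+ 2 <= 2 * C0 / k by lra.
have -> : 2 * C0 / (k + 1) + C0 / k ^+ 2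
    = C0 * (2 * k ^+ 2 + (k + 1)) / (k ^+ 2 * (k + 1)).
  by field; apply/andP; split; apply: lt0r_neq0; lra.
have -> : 2 * C0 / k = C0 * (2 * k * (k + 1)) / (k ^+ 2 * (k + 1)).
  by field; apply/andP; split; apply: lt0r_neq0; lra.
apply: ler_wpM2r; first by rewrite invr_ge0 mulr_ge0 ?sqr_ge0 //; lra.
by apply: ler_wpM2l => //; lra.
Qed.

Lemma YX_block_bound q :
  Ex P (fun om => sqn (Y *m X (q * n.+1)%N om)) <= 1 + (sqn (Y *m x0) + 2 * C0).
Proof.
apply: (@le_trans _ _ (Ex P (fun om => 1 + lyap 1 (sqn (Y *m X (q * n.+1)%N om))))).
  apply: Ex_le; [exact: MX_sqn|apply: itgD; [exact: itg_cst|exact: lyap_itg]|].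
  by move=> om; have := lyap1_ge (sqn (Y *m X (q * n.+1)%N om)) (sqn_ge0 _); lra.
rewrite (ExD P _ _ (itg_cst P 1) (lyap_itg 1 _)) Ex_cst lerD2l.
by have := lyap_expectation q 1 (lexx _); rewrite divr1.
Qed.

(** Between block starts the second moment grows per step by at most a factor 4 plus a constant, and
    blocks have fixed length. *)
Lemma YX_bound : exists K : R, forall t, Ex P (fun om => sqn (Y *m X t om)) <= K.
Proof.
pose K0 := 1 + (sqn (Y *m x0) + 2 * C0).
have K00 : 0 <= K0.
  apply: addr_ge0 => //; apply: addr_ge0; first exact: sqn_ge0.
  by apply: mulr_ge0 => //; exact: C0_ge0.
pose K1 := 4 * (frob (Y *m B) ^+ 2 * Gs ^+ 2) + 2 * (frob Y ^+ 2 * (1 + M)).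
have K10 : 0 <= K1.
  apply: addr_ge0; apply: mulr_ge0 => //; apply: mulr_ge0; rewrite ?sqr_ge0 //.
  by apply: addr_ge0 => //; exact: M_ge0.
have step t : Ex P (fun om => sqn (Y *m X t.+1 om))
    <= 4 * Ex P (fun om => sqn (Y *m X t om)) + K1.
  have [wi wM] := w_sqn t.
  have h1 := itgZ P 4 _ (MX_sqn _ Y t).
  have h2 := itg_cst P (4 * (frob (Y *m B) ^+ 2 * Gs ^+ 2)).
  have h3 := itgZ P (2 * frob Y ^+ 2) _ wi.
  apply: (@le_trans _ _ (Ex P (fun om => 4 * sqn (Y *m X t om)
    + (4 * (frob (Y *m B) ^+ 2 * Gs ^+ 2) + 2 * frob Y ^+ 2 * sqn (w t om))))).
    apply: Ex_le; [exact: MX_sqn|exact: itgD h1 (itgD P _ _ h2 h3)|move=> om].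
    have -> : Y *m X t.+1 om = Y *m A *m X t om + Y *m B *m U t om + Y *m w t om.
      by rewrite /X cl_trajS !mulmxDr !mulmxA.
    have a0 := sqn_affine_le _ (Y *m A *m X t om) (Y *m B *m U t om) (Y *m w t om).
    have a1 : sqn (Y *m A *m X t om) = sqn (Y *m X t om).
      by rewrite -!enorm_sqr -[Y *m A]/(Y *m A ^+ 1) enorm_YA.
    have a2 : sqn (Y *m B *m U t om) <= frob (Y *m B) ^+ 2 * Gs ^+ 2.
      apply: le_trans (sqn_mulmx _ _) _.
      by apply: ler_wpM2l; [exact: sqr_ge0|exact: sqn_U].
    by have a3 := sqn_mulmx Y (w t om); lra.
  rewrite (ExD P _ _ h1 (itgD P _ _ h2 h3)) (ExD P _ _ h2 h3).
  rewrite (ExZ P _ _ (MX_sqn _ Y t)) (ExZ P _ _ wi) Ex_cst lerD2l /K1 lerD2l -mulrA.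
  by apply: ler_wpM2l => //; apply: ler_wpM2l => //; exact: sqr_ge0.
(* The subtracted [K1] absorbs the additive constant of each step. *)
have inblock q j : Ex P (fun om => sqn (Y *m X (q * n.+1 + j)%N om))
    <= 4 ^+ j * (K0 + K1) - K1.
  elim: j => [|j IH]; first by rewrite addn0 expr0 mul1r addrK; exact: YX_block_bound.
  rewrite addnS; apply: le_trans (step _) _; rewrite exprS -mulrA.
  have := ler_wpM2l (ler0n R 4) IH; rewrite mulrBr; lra.
exists (4 ^+ n.+1 * (K0 + K1)) => t; rewrite (divn_eq t n.+1).
apply: le_trans (inblock _ _) _; rewrite lerBlDr; apply: le_trans (_ : _ <= _) (ler_wpDr K10 (lexx _)).
apply: ler_wpM2r; first exact: addr_ge0.
apply: ler_weXn2l; first lra.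
by rewrite ltnW // ltn_mod.
Qed.

(** The state is a stable filter of the inputs [e], whose second moments are bounded. Pathwise its
    norm has a scalar majorant, and the square of that is dominated by a filter linear in |e|^2. *)
Lemma X_bound : exists K : R, forall t, Ex P (fun om => sqn (X t om)) <= K.
Proof.
have [K HK] := YX_bound.
pose e t om := L *m (Y *m X t om) + B *m U t om + w t om.
pose K2 := 4 * (frob L ^+ 2 * K) + (4 * (frob B ^+ 2 * Gs ^+ 2) + 2 * (1 + M)).
have em t : vmeas (e t).
  apply: vmeasD; last exact: mw.
  apply: vmeasD; first by do 2 apply: vmeas_mulmx; exact: X_vmeas.
  apply: vmeas_mulmx; apply: vmeasN; apply: vmeasZ.
    by apply: measurable_sat; apply: vmeas_mulmx; exact: X_vmeas.
  by do 2 apply: vmeas_mulmx; exact: X_vmeas.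
have eb t : itg P (fun om => sqn (e t om)) /\ Ex P (fun om => sqn (e t om)) <= K2.
  have [wi wM] := w_sqn t.
  have h1 := itgZ P (4 * frob L ^+ 2) _ (MX_sqn _ Y t).
  have h2 := itg_cst P (4 * (frob B ^+ 2 * Gs ^+ 2)).
  have h3 := itgZ P 2 _ wi.
  have h23 := itgD P _ _ h2 h3; have h123 := itgD P _ _ h1 h23.
  have le om : sqn (e t om) <= 4 * frob L ^+ 2 * sqn (Y *m X t om)
      + (4 * (frob B ^+ 2 * Gs ^+ 2) + 2 * sqn (w t om)).
    apply: le_trans (sqn_affine_le _ _ _ _) _; rewrite addrA.
    apply: lerD => //; apply: lerD.
      by rewrite -mulrA; apply: ler_wpM2l => //; exact: sqn_mulmx.
    apply: ler_wpM2l => //; apply: le_trans (sqn_mulmx _ _) _.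
    by apply: ler_wpM2l; [exact: sqr_ge0|exact: sqn_U].
  have ei : itg P (fun om => sqn (e t om)).
    apply: itg_le h123 _; first exact: measurable_sqn.
    by move=> om; rewrite ger0_norm ?sqn_ge0.
  split=> //; apply: le_trans (Ex_le P _ _ ei h123 le) _.
  rewrite (ExD P _ _ h1 h23) (ExD P _ _ h2 h3) (ExZ P _ _ (MX_sqn _ Y t)).
  rewrite (ExZ P _ _ wi) Ex_cst /K2 -mulrA; apply: lerD.
    by apply: ler_wpM2l => //; apply: ler_wpM2l; [exact: sqr_ge0|exact: HK].
  by rewrite lerD2l; apply: ler_wpM2l.
have /andP[r0 r1] := rho01; have r1' : 0 < 1 - rho by lra.
pose b t om := geom_majorant rho (sqn x0) (fun t => (1 - rho)^-1 * sqn (e t om)) t.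
(* Chosen so that rho Kb + K2 / (1 - rho) <= Kb, which the recursion of [b] preserves. *)
pose Kb := sqn x0 + K2 / (1 - rho) ^+ 2.
have K20 : 0 <= K2.
  apply: le_trans (eb 0%N).2; apply: Rintegral_ge0 => om _; exact: sqn_ge0.
have bb t : itg P (b t) /\ Ex P (b t) <= Kb.
  elim: t => [|t [IHi IH]].
    split; first exact: itg_cst.
    rewrite (_ : b 0%N = fun=> sqn x0) // Ex_cst lerDl.
    by apply: divr_ge0 => //; exact: sqr_ge0.
  have [ei eK] := eb t; have h1 := itgZ P rho _ IHi.
  have h2 := itgZ P (1 - rho)^-1 _ ei.
  split; first exact: (itgD P _ _ h1 h2).
  rewrite (_ : b t.+1 = fun om => rho * b t om + (1 - rho)^-1 * sqn (e t om)) //.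
  rewrite (ExD P _ _ h1 h2) (ExZ P _ _ IHi) (ExZ P _ _ ei).
  have s1 : rho * Ex P (b t) <= rho * Kb by rewrite ler_wpM2l // ltW.
  have s2 : (1 - rho)^-1 * Ex P (fun om => sqn (e t om)) <= (1 - rho)^-1 * K2.
    by rewrite ler_wpM2l // invr_ge0 ltW.
  have s3 : (1 - rho)^-1 * K2 <= (1 - rho) * Kb.
    have -> : (1 - rho) * Kb = (1 - rho) * sqn x0 + (1 - rho)^-1 * K2.
      by rewrite /Kb; field; exact: lt0r_neq0.
    by rewrite lerDr; apply: mulr_ge0; [exact: ltW|exact: sqn_ge0].
  by have := lerD s1 (le_trans s2 s3); lra.
have ab t om : geom_majorant rho (enorm x0) (fun t => enorm (e t om)) t ^+ 2
    <= b t om.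
  elim: t => [|t IH]; first by rewrite /b /= enorm_sqr.
  rewrite /b /= -/(b t om) -enorm_sqr.
  move: (geom_majorant _ _ _ t) IH (enorm (e t om)) => a IH y.
  (* Convexity of the square: rho a + y is the mean of a and y / (1 - rho) with weights rho and 1 -
     rho. *)
  have h : (rho * a + y) ^+ 2 <= rho * a ^+ 2 + (1 - rho)^-1 * y ^+ 2.
    have -> : rho * a ^+ 2 + (1 - rho)^-1 * y ^+ 2
       = (rho * a + y) ^+ 2 + rho * (1 - rho) * (a - y / (1 - rho)) ^+ 2.
      by field; exact: lt0r_neq0.
    by rewrite lerDl; apply: mulr_ge0; [apply: mulr_ge0; exact: ltW|exact: sqr_ge0].
  apply: le_trans h _; rewrite lerD2r; apply: ler_wpM2l => //; exact: ltW.
exists ((n.+1%:R * c) ^+ 2 * Kb) => t.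
have h := itgZ P ((n.+1%:R * c) ^+ 2) _ (bb t).1.
apply: (@le_trans _ _ (Ex P (fun om => (n.+1%:R * c) ^+ 2 * b t om))).
  apply: Ex_le => [|//|om]; first exact: X_sqn.
  have rec s : X s.+1 om = (A - L *m Y) *m X s om + e s om.
    exact: stable_recursion.
  have maj := stable_majorant _ c rho (ltW r0) Fdecay (fun s => X s om)
    (fun s => e s om) rec t.
  apply: (@le_trans _ _ ((n.+1%:R * c
    * geom_majorant rho (enorm x0) (fun t => enorm (e t om)) t) ^+ 2)).
    rewrite -enorm_sqr lerXn2r ?nnegrE ?enorm_ge0 //.
    exact: le_trans (enorm_ge0 _) maj.
  by rewrite exprMn; apply: ler_wpM2l; [exact: sqr_ge0|exact: ab].
rewrite (ExZ P _ _ (bb t).1); apply: ler_wpM2l; first exact: sqr_ge0.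
exact: (bb t).2.
Qed.

Lemma second_moment_bound : exists K : R, forall t,
  (\int[P]_om (enorm (X t om) ^+ 2)%:E <= K%:E)%E.
Proof.
have [K HK] := X_bound; exists K => t.
rewrite (_ : (\int[P]_om _)%E = (\int[P]_om (sqn (X t om))%:E)%E); last first.
  by apply: eq_integral => om _; rewrite enorm_sqr.
by rewrite Ex_fin ?lee_fin //; exact: X_sqn.
Qed.

End FromInitialState.
End Moments.

(** * Existence of the bounded stabilizing policy *)

Theorem theorem1 (R : realType) (d m : nat) (A : 'M[R]_d) (B : 'M[R]_(d, m))
  (dO : measure_display) (Omega : measurableType dO) (P : probability Omega R)
  (w : nat -> Omega -> 'cV[R]_d) :
  (forall l : R[i], eigenvalue (toC A) l -> `|l| <= 1) ->
  (forall l : R[i], eigenvalue (toC A) l -> `|l| = 1 ->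
      mup l (char_poly (toC A)) = \rank (eigenspace (toC A) l)) ->
  stabilizable A B ->
  (forall (t : nat) (i : 'I_d), measurable_fun setT (fun om => w t om i 0)) ->
  mutually_independent P w ->
  (forall (t : nat) (i : 'I_d), (\int[P]_om (w t om i 0)%:E = 0)%E) ->
  (exists M : R, forall t : nat, (\int[P]_om ((enorm (w t om)) ^+ 4)%:E <= M%:E)%E) ->
  exists (Rb : R) (k : nat), 0 < Rb /\ (k <= d)%N /\
    exists pi : nat -> 'M[R]_(d, k) -> 'cV[R]_m,
      (forall t, mx_measurable_fun (pi t)) /\
      (forall t (H : 'M[R]_(d, k)), enorm (pi t H) <= Rb) /\
      (forall x : 'cV[R]_d, exists M : R, forall t : nat,
         (\int[P]_om ((enorm (cl_traj A B pi (fun s => w s om) x t)) ^+ 2)%:E <= M%:E)%E) /\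
      asymp_stable (cl_traj A B pi (fun _ => 0)).
Proof.
move=> le1 semi stab mw indw w_mean [M w_moment].
(* In dimension zero every norm is 0, and the zero policy with empty history serves. *)
case: d => [|n] in A B w le1 semi stab mw indw w_mean w_moment *.
  have flat (v : 'cV[R]_0) : enorm v = 0 by rewrite [v]flatmx0 enorm0.
  exists 1, 0%N; split=> //; split=> //; exists (fun _ _ => 0); split.
    by move=> t; apply: mx_measurable_entries => i j; exact: measurable_cst.
  split; first by move=> t H; rewrite enorm0.
  split; last first.
    split=> [e e0|]; exists 1 => // x _; first by move=> t; rewrite flat.
    by move=> e e0; exists 0%N => t _; rewrite flat.
  move=> x; exists 0 => t.
  under eq_integral => om _ do rewrite flat expr0n.
  by rewrite integral0.
have [N [Y [L [G [c [rho [YA rho01 Fdecay YG]]]]]]] :=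
  linear_structure _ _ _ A B le1 semi stab.
(* The added 1 makes the bound positive even when all gains vanish. *)
exists (\sum_(i < n.+1) frob (G i) + 1), n.+1; split.
  by rewrite ltr_wpDl // sumr_ge0 // => i _; exact: frob_ge0.
split=> //; exists (policy Y G); split; first exact: measurable_policy.
split.
  by move=> t H; apply: le_trans (enorm_policy _ _ _ _) _; rewrite lerDl.
split; last exact: (policy_asymp_stable A B Y L G c rho).
move=> x; exact: (second_moment_bound P A B Y L G c rho YA rho01 Fdecay YG w M).
Qed.
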